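(* Let $\gamma\in\mathcal{C}$ with $\mathcal{E}(\gamma)<\infty$ and let $c,\overline{c}>0$. For each $n\geq 2$ let $p_{n}$ be an inscribed polygon of $\gamma$ given by a subdivision $b_{k}$, $k=1,\dots,n$ (depending on $n$), of $\mathbb{S}_{1}$ such that $$\frac{c}{n}\leq\min_{k=1,\dots,n}|\gamma(b_{k+1})-\gamma(b_{k})|\leq\max_{k=1,\dots,n}|\gamma(b_{k+1})-\gamma(b_{k})|\leq\frac{\overline{c}}{n}.$$ Then $\lim_{n\to\infty}\mathcal{E}_{n}(p_{n})=\mathcal{E}(\gamma)$.
   Context: $\mathbb{S}_{L}$ is the circle of length $L$ and $d(\cdot,\cdot)$ denotes the intrinsic (shortest arc) metric on a circle. $\mathcal{C}$ is the set of closed curves $\gamma:\mathbb{S}_{1}\to\mathbb{R}^{d}$ of length $1$ parametrised by arc length (Lipschitz, $|\gamma'|=1$ a.e.). The Möbius energy of $\gamma\in\mathcal{C}$ is $$\mathcal{E}(\gamma)=\int_{\mathbb{S}_{1}}\int_{\mathbb{S}_{1}}\Big(\frac{1}{|\gamma(t)-\gamma(s)|^{2}}-\frac{1}{d(t,s)^{2}}\Big)\,ds\,dt\in[0,\infty],$$ where $1/0=+\infty$. A subdivision $b_{1},\dots,b_{n}$ of $\mathbb{S}_{1}$ consists of $n$ points in consecutive (cyclic) order, with indices mod $n$ ($b_{n+1}=b_{1}$). The inscribed polygon given by it is the closed polygon with consecutive vertices $\gamma(b_{1}),\dots,\gamma(b_{n})$, parametrised by arc length over $\mathbb{S}_{\tilde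 L}$, where $\tilde L=\sum_{k=1}^n|\gamma(b_{k+1})-\gamma(b_{k})|$ is its length. For a closed polygon $p$ with $n$ segments and length $\tilde L$, parametrised by arc length over $\mathbb{S}_{\tilde L}$ with vertices $p(a_{1}),\dots,p(a_{n})$ at consecutive arc length parameters $a_{1},\dots,a_{n}\in\mathbb{S}_{\tilde L}$ (indices mod $n$), the discrete Möbius energy is $$\mathcal{E}_{n}(p)=\sum_{\substack{i,j=1\\ i\neq j}}^{n}\Big(\frac{1}{|p(a_{j})-p(a_{i})|^{2}}-\frac{1}{d(a_{j},a_{i})^{2}}\Big)\,|p(a_{i+1})-p(a_{i})|\,|p(a_{j+1})-p(a_{j})|,$$ where $d$ is the intrinsic metric of $\mathbb{S}_{\tilde L}$. *)

(* Defs.v *)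
From HB Require Import structures.
From mathcomp Require Import all_boot all_order all_algebra.
From mathcomp Require Import all_classical all_reals all_analysis.
From mathcomp Require Import lra.

Set Implicit Arguments.
Unset Strict Implicit.
Unset Printing Implicit Defensive.

Import Order.TTheory GRing.Theory Num.Theory.
Import numFieldNormedType.Exports.

Local Open Scope classical_set_scope.
Local Open Scope ring_scope.

(* The circle of length L is R / L Z.  A map on it is an L-periodic map on R,
   and a point of it is given by any of its lifts to R. *)

(* The library norm on 'rV[R]_d is the sup norm. *)
Definition enorm (R : realType) (d : nat) (x : 'rV[R]_d) : R :=
  Num.sqrt (\sum_(i < d) x ord0 i ^+ 2).

(* The quotient metric: every lift of the difference is the signed length of
   an arc joining the two points (possibly winding around the circle). *)
Definition circle_dist (R : realType) (L s t : R) : R :=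
  inf [set `|s - t + k%:~R * L| | k in [set: int]].

Lemma circle_distE (R : realType) (L s t : R) : 0 < L -> `|s - t| <= L ->
  circle_dist L s t = Num.min `|s - t| (L - `|s - t|).
Proof.
rewrite /circle_dist; move: (s - t) => x L0 xL.
have lbS : lbound [set `|x + k%:~R * L| | k in [set: int]]
    (Num.min `|x| (L - `|x|)).
  move=> _ [k _ <-]; rewrite ge_min; case: (eqVneq k 0) => [->|k0].
    by rewrite mul0r addr0 lexx.
  apply/orP; right.
  have : L <= `|k%:~R * L|.
    rewrite normrM (gtr0_norm L0) ler_peMl ?(ltW L0)//.
    by rewrite -intr_norm (ler_int _ 1) -gtz0_ge1 normr_gt0.
  have := ler_normB (x + k%:~R * L) x; rewrite (addrC x) addrK.
  by lra.
have Sx k : `|x + k%:~R * L| \in [set `|x + k%:~R * L| | k in [set: int]].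
  by rewrite inE; exists k.
apply/eqP; rewrite eq_le; apply/andP; split; last first.
  by apply: lb_le_inf lbS; exists `|x + 0%:~R * L|; exists 0.
have lbS' : has_lbound [set `|x + k%:~R * L| | k in [set: int]].
  by exists (Num.min `|x| (L - `|x|)).
rewrite le_min; apply/andP; split; apply: ge_inf => //.
  by exists 0 => //; rewrite mul0r addr0.
case: (leP 0 x) => x0.
  exists (- 1) => //; rewrite mulN1r distrC ger0_norm ?(ger0_norm x0)//.
  by move: xL; rewrite (ger0_norm x0); lra.
exists 1 => //; rewrite mul1r; move: xL; rewrite (ltr0_norm x0) => xL.
by rewrite ger0_norm; lra.
Qed.

Definition arclength_closed_curve (R : realType) (d : nat)
    (g : R -> 'rV[R]_d) : Prop :=
  [/\ periodic g 1,
      [lipschitz g x | x in [set: R]] &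
      {ae @lebesgue_measure R, forall t, derivable g t 1 /\ enorm ('D_1 g t) = 1}].

(* The inverse is that of the extended reals, for which 0^-1 = +oo.  The
   conventional value of the integrand on the diagonal, where it reads
   +oo - +oo, is immaterial since the diagonal is negligible. *)
Definition moebius_energy (R : realType) (d : nat) (g : R -> 'rV[R]_d) :
    \bar R :=
  (\int[@lebesgue_measure R]_(t in `[0%R, 1%R])
    \int[@lebesgue_measure R]_(s in `[0%R, 1%R])
      ((enorm (g t - g s)%R ^+ 2)%:E^-1 - (circle_dist 1%R t s ^+ 2)%:E^-1))%E.

(* n distinct points of the circle of length L in cyclic order, lifted to
   increasing numbers b_0 < ... < b_(n-1) < b_0 + L. *)
Definition subdivision (R : realType) (L : R) (n : nat) (b : 'I_n -> R) : Prop :=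
  (forall i j : 'I_n, (i < j)%N -> b i < b j) /\ (forall i j, b j < b i + L).

(* The lift of the cyclic successor of b_i which follows b_i in R. *)
Definition next_lift (R : realType) (L : R) (n : nat) (b : 'I_n -> R)
    (i : 'I_n) : R :=
  if i.+1 == n then b (ordS i) + L else b (ordS i).

(* The edges of the closed polygonal line through v_0, ..., v_(n-1): since
   ordS is the successor modulo n, the last edge joins v_(n-1) to v_0. *)
Definition edge_length (R : realType) (d n : nat) (v : 'I_n -> 'rV[R]_d)
    (k : 'I_n) : R :=
  enorm (v (ordS k) - v k).

Definition polygon_length (R : realType) (d n : nat) (v : 'I_n -> 'rV[R]_d) : R :=
  \sum_(k < n) edge_length v k.

Definition arclength_closed_polygon (R : realType) (d n : nat) (L : R)
    (p : R -> 'rV[R]_d) (a : 'I_n -> R) : Prop :=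
  [/\ periodic p L,
      subdivision L a,
      forall i, edge_length (p \o a) i = next_lift L a i - a i &
      forall i (x : R), 0 <= x <= 1 ->
        p ((1 - x) * a i + x * next_lift L a i) =
        (1 - x) *: p (a i) + x *: p (a (ordS i))].

Definition inscribed_polygon (R : realType) (d n : nat) (g : R -> 'rV[R]_d)
    (b : 'I_n -> R) (p : R -> 'rV[R]_d) (a : 'I_n -> R) : Prop :=
  arclength_closed_polygon (polygon_length (g \o b)) p a /\
  forall k, p (a k) = g (b k).

Definition discrete_moebius_energy (R : realType) (d n : nat) (L : R)
    (p : R -> 'rV[R]_d) (a : 'I_n -> R) : \bar R :=
  (\sum_(i < n) \sum_(j < n | i != j)
    ((enorm (p (a j) - p (a i))%R ^+ 2)%:E^-1
      - (circle_dist L (a j) (a i) ^+ 2)%:E^-1)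
    * (edge_length (p \o a) i)%:E
    * (edge_length (p \o a) j)%:E)%E.

(* Main.v *)
Require Import Defs.
From HB Require Import structures.
From mathcomp Require Import all_boot all_order all_algebra.
From mathcomp Require Import all_classical all_reals all_analysis.
From mathcomp Require Import measurable_realfun zify ring lra.

Import Order.TTheory GRing.Theory Num.Theory.
Import numFieldNormedType.Exports.

Local Open Scope classical_set_scope.
Local Open Scope ring_scope.

(** Write D for the intrinsic distance and |.| for the chord of two points of
the curve.  The curve is 1-Lipschitz, so by the triangle inequality the defect
D^2 - |.|^2 of an arc can only grow when the arc is prolonged.  Finite energy
then does all the work.

A chord much shorter than D would force the energy of a small square to exceed
a fixed constant, so the curve is bilipschitz, by absolute continuity of the
integral.  With the edge bounds, all parameter gaps b_{i+1} - b_i are therefore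
of order 1/n, and they cut the square into cells whose energies sum to
E(gamma).  Near the diagonal, monotonicity of the defect bounds the (i,j) term
of the discrete energy by a constant times the energy of the cell just outside
the arc from b_i to b_j, hence these terms are negligible because the energy of
a thin strip around the diagonal is.  The same estimate on each single edge
gives 1 - L_n = O(E(gamma) / n).  Away from the diagonal the integrand is
Lipschitz, and term and cell energy differ by O(1/n + (1 - L_n)) times the area
of the cell. *)

(** * Euclidean norm *)

Section Enorm.
Context {R : realType} {d : nat}.
Implicit Types x y z : 'rV[R]_d.

Lemma enorm_ge0 x : 0 <= enorm x.
Proof. exact: sqrtr_ge0. Qed.

Lemma enorm_sqr x : enorm x ^+ 2 = \sum_(i < d) x ord0 i ^+ 2.
Proof. by rewrite sqr_sqrtr// sumr_ge0// => i _; rewrite sqr_ge0. Qed.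

Lemma enorm0 : enorm (0 : 'rV[R]_d) = 0.
Proof. by rewrite /enorm big1 ?sqrtr0// => i _; rewrite mxE expr0n. Qed.

Lemma enormN x : enorm (- x) = enorm x.
Proof. by congr Num.sqrt; apply: eq_bigr => i _; rewrite mxE sqrrN. Qed.

Lemma enormB x y : enorm (x - y) = enorm (y - x).
Proof. by rewrite -enormN opprB. Qed.

(** The squared coordinates of [enorm y *: x - enorm x *: y] sum to [2 |x| |y| (|x| |y| - S)], with
    [S] the inner product. Divide by the factor [2 |x| |y|] when it is positive; otherwise one of
    the vectors is 0. *)
Lemma cauchy_schwarz_enorm x y :
  \sum_(i < d) x ord0 i * y ord0 i <= enorm x * enorm y.
Proof.
set S := \sum_(i < d) _.
have xy0 : 0 <= enorm x * enorm y by rewrite mulr_ge0 ?enorm_ge0.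
have H : 0 <= 2 * (enorm x * enorm y) * (enorm x * enorm y - S).
  have -> : 2 * (enorm x * enorm y) * (enorm x * enorm y - S) =
      \sum_(i < d) (enorm y * x ord0 i - enorm x * y ord0 i) ^+ 2.
    rewrite (eq_bigr (fun i => enorm y ^+ 2 * x ord0 i ^+ 2 +
        (- (2 * (enorm x * enorm y) * (x ord0 i * y ord0 i)) +
        enorm x ^+ 2 * y ord0 i ^+ 2))); last by move=> i _; ring.
    by rewrite !big_split/= sumrN -!mulr_sumr -!enorm_sqr -/S; ring.
  by apply: sumr_ge0 => i _; exact: sqr_ge0.
have [xy_gt0|] := ltP 0 (enorm x * enorm y).
  have k0 : 0 < 2 * (enorm x * enorm y) by lra.
  by move: H; rewrite pmulr_rge0// subr_ge0.
move=> xy_le0; have /eqP := le_anti (introT andP (conj xy_le0 xy0)).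
rewrite mulf_eq0 => /orP[] /eqP z0; rewrite /S.
  have : enorm x ^+ 2 = 0 by rewrite z0 expr0n.
  rewrite enorm_sqr => /eqP; rewrite psumr_eq0 => [/allP xi0|i _]; last exact: sqr_ge0.
  rewrite big1// => i _; have := xi0 i (mem_index_enum _).
  by rewrite sqrf_eq0 => /eqP ->; rewrite mul0r.
have : enorm y ^+ 2 = 0 by rewrite z0 expr0n.
rewrite enorm_sqr => /eqP; rewrite psumr_eq0 => [/allP xi0|i _]; last exact: sqr_ge0.
rewrite big1// => i _; have := xi0 i (mem_index_enum _).
by rewrite sqrf_eq0 => /eqP ->; rewrite mulr0.
Qed.

Lemma enormD x y : enorm (x + y) <= enorm x + enorm y.
Proof.
rewrite -(@ler_pXn2r _ 2) ?nnegrE ?addr_ge0 ?enorm_ge0//.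
rewrite sqrrD !enorm_sqr.
rewrite (eq_bigr (fun i => x ord0 i ^+ 2 +
    (2 * (x ord0 i * y ord0 i) + y ord0 i ^+ 2))); last first.
  by move=> i _; rewrite mxE; ring.
rewrite !big_split/= -mulr_sumr -!enorm_sqr.
by have := cauchy_schwarz_enorm x y; lra.
Qed.

Lemma enorm_triangle x y z : enorm (x - z) <= enorm (x - y) + enorm (y - z).
Proof. by rewrite (le_trans _ (enormD _ _))// addrA subrK. Qed.

End Enorm.

(** * Curves parametrised by arc length *)

(** A mean value inequality whose derivative bound holds only almost everywhere; the Lipschitz bound
    pays for the exceptional null set. The proof is a continuity induction: the estimate with an
    error [e] passes to the supremum [u] of the points where it holds, and if [u < t] it extends
    beyond [u]. *)
Lemma lipschitz_ae_derive_le {R : realType} (h : R -> R) (K M : R) :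
  (forall x y, `|h x - h y| <= K * `|x - y|) ->
  {ae @lebesgue_measure R, forall x, derivable h x 1 /\ 'D_1 h x <= M} ->
  forall s t, s <= t -> h t - h s <= M * (t - s).
Proof.
move=> hK [N [mN N0 subN]] s t st.
have K0 : 0 <= K.
  by have := hK 1 0; rewrite subr0 normr1 mulr1; apply: le_trans.
pose K' := K + `|M|.
(* An open set U of small measure covers the exceptional set.  On U the growth
   of h is charged to the measure m x of U below x, elsewhere to the derivative. *)
suff main e : 0 < e -> h t - h s <= (M + e) * (t - s) + K' * e.
  apply/ler_addgt0Pr => e e0.
  (* [D] exceeds [t - s + K'], so running the estimate with [e / D] costs at most [e] in total. *)
  pose D := t - s + K' + 1.
  have D0 : 0 < D by rewrite /D /K'; have := normr_ge0 M; lra.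
  have /main : 0 < e / D by rewrite divr_gt0.
  move=> /le_trans; apply.
  have -> : (M + e / D) * (t - s) + K' * (e / D) = M * (t - s) + e * ((t - s + K') / D).
    by field; rewrite gt_eqF.
  rewrite lerD2l ler_piMr ?(ltW e0)// ler_pdivrMr// mul1r /D; lra.
move=> e0.
have [|U [oU NU Ue]] := @lebesgue_regularity_outer R N e mN _ e0.
  by rewrite [ltLHS]N0.
have mU : measurable U by exact: open_measurable.
have {}Ue : (lebesgue_measure U < e%:E)%E.
  rewrite -(setDUK NU) measureU ?setDIK//; last exact: measurableD.
  by rewrite [X in (X + _)%E]N0 add0e.
pose m x := fine (lebesgue_measure (U `&` `]s, x])).
have mfin x : lebesgue_measure (U `&` `]s, x]) \is a fin_num.
  rewrite ge0_fin_numE//; apply: le_lt_trans (ltry e).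
  apply: le_trans (ltW Ue); apply: le_measure; rewrite ?inE//.
  exact: measurableI.
have mle x y : x <= y -> m x <= m y.
  move=> xy; rewrite /m fine_le//; apply: le_measure; rewrite ?inE//.
  - exact: measurableI.
  - exact: measurableI.
  - by apply: setIS; apply: subset_itvl; rewrite bnd_simp.
have me x : m x <= e.
  rewrite -lee_fin /m fineK//; apply: le_trans (ltW Ue).
  by apply: le_measure; rewrite ?inE//; exact: measurableI.
have m0 : 0 <= m s by rewrite /m fine_ge0.
have mU' x y : s <= x -> x <= y -> `]x, y] `<=` U -> m x + (y - x) <= m y.
  move=> sx xy xyU; rewrite -lee_fin EFinD !fineK//.
  have -> : (y - x)%:E = lebesgue_measure (U `&` `]x, y] : set R).
    rewrite setIidr// lebesgue_measure_itv/= lte_fin.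
    by case: ltP => // yx; congr _%:E; lra.
  rewrite -measureU; [|exact: measurableI|exact: measurableI|].
    apply: le_measure; rewrite ?inE//.
    + by apply: measurableU; exact: measurableI.
    + exact: measurableI.
    + by move=> z [] [Uz]; rewrite /= in_itv/= => /andP[z1 z2]; split => //;
        rewrite /= in_itv/=; apply/andP; split; lra.
  by apply/seteqP; split => // z [[_ /=]] + [_ /=]; rewrite !in_itv/= => /andP[_ ?] /andP[+ _]; lra.
pose P x := h x - h s <= (M + e) * (x - s) + K' * m x.
suff : P t by move=> /le_trans; apply; rewrite lerD2l ler_wpM2l// addr_ge0.
have K'0 : 0 <= K' by rewrite addr_ge0.
pose A := [set x | s <= x <= t /\ P x].
have As : A s.
  split; first by rewrite lexx.
  by rewrite /P !subrr mulr0 add0r mulr_ge0.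
have supA : has_sup A by split; [exists s|exists t => x [/andP[]]].
set u := sup A.
have su : s <= u by exact: (sup_upper_bound supA).
have ut : u <= t by apply: ge_sup; [exists s|move=> x [/andP[]]].
(* [m] is nondecreasing and [h] is Lipschitz, which carries the estimate from points just below [u]
   to [u]. *)
have Pu : P u.
  rewrite /P; apply/ler_addgt0Pr => eta eta0.
  pose D := K + `|M + e| + 1.
  have D0 : 0 < D by rewrite /D; have := normr_ge0 (M + e); lra.
  have : 0 < eta / D by rewrite divr_gt0.
  move=> /(sup_adherent)/(_ supA)[x [/andP[sx xt] Px] ux].
  have xu : x <= u by apply: (sup_upper_bound supA); split => //; apply/andP.
  have {}ux : u - x <= eta / D by move: ux; rewrite -/u; lra.
  have h1 : h u - h x <= K * (u - x).
    have := hK u x; rewrite (ger0_norm (_ : 0 <= u - x)) ?subr_ge0//.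
    by apply: le_trans; exact: ler_norm.
  have h2 : K' * m x <= K' * m u by rewrite ler_wpM2l// mle.
  have h3 : - `|M + e| * (u - x) <= (M + e) * (u - x).
    by rewrite ler_wpM2r ?subr_ge0// lerNl -normrN ler_norm.
  have h4 : D * (u - x) <= eta by rewrite mulrC -ler_pdivlMr.
  move: Px; rewrite /P => Px; rewrite /D in h4.
  by nra.
have [<-//|/eqP unt] := eqVneq u t.
have {}unt : u < t by rewrite lt_neqAle ut andbT; apply/eqP.
suff [y [uy yt hy]] : exists y, [/\ u < y, y <= t &
    h y - h u <= (M + e) * (y - u) + K' * (m y - m u)].
  have : A y.
    split; first by apply/andP; split => //; lra.
    by move: Pu hy; rewrite /P => Pu hy; lra.
  move=> /(ub_le_sup (proj2 supA)); rewrite -/u; lra.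
(* Inside the open set [h] grows at rate at most [K] while [m] grows at rate 1; the extra [|M|] in
   [K'] covers a negative [M]. Outside, the derivative at [u] exists and is below [M + e], hence so
   are the difference quotients over short steps. *)
have [Uu|NUu] := pselect (U u).
  have /nbhs_ballP[r /= r0 ru] := open_nbhs_nbhs (conj oU Uu).
  pose y := u + Num.min (r / 2) (t - u).
  have y1 : u < y by rewrite /y ltrDl lt_min divr_gt0//= subr_gt0.
  have y2 : y <= t by rewrite /y -lerBrDl ge_min lexx orbT.
  have y3 : y - u < r.
    rewrite /y; have : Num.min (r / 2) (t - u) <= r / 2 by rewrite ge_min lexx.
    lra.
  exists y; split => //.
  have /(mU' _ _ su (ltW y1)) my : `]u, y] `<=` U.
    move=> z /=; rewrite in_itv/= => /andP[uz zy]; apply: ru.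
    by rewrite /ball/= ltr_distlC; apply/andP; split; lra.
  have h1 : h y - h u <= K * (y - u).
    have := hK y u; rewrite (ger0_norm (_ : 0 <= y - u)) ?subr_ge0 ?(ltW y1)//.
    by apply: le_trans; exact: ler_norm.
  have h2 : K' * (y - u) <= K' * (m y - m u) by rewrite ler_wpM2l//; lra.
  have h3 : - `|M| * (y - u) <= M * (y - u).
    by rewrite ler_wpM2r ?subr_ge0 ?(ltW y1)// lerNl -normrN ler_norm.
  have h4 : 0 <= e * (y - u) by rewrite mulr_ge0// ?ltW// subr_gt0.
  by rewrite /K' in h2 *; lra.
have [du dM] : derivable h u 1 /\ 'D_1 h u <= M.
  by apply: contrapT => /subN/NU.
have cvgD : x^-1 *: ((h \o shift u) (x *: 1) - h u) @[x --> 0^'] --> 'D_1 h u by [].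
have Me : 'D_1 h u < M + e by lra.
have := cvgr_lt _ cvgD _ Me.
move=> [r /= r0 hr].
pose x := Num.min (r / 2) (t - u).
have x1 : 0 < x by rewrite lt_min divr_gt0//= subr_gt0.
have x2 : x <= t - u by rewrite ge_min lexx orbT.
have x3 : x <= r / 2 by rewrite ge_min lexx.
exists (u + x); split; [by lra|by lra|].
have /hr : ball 0 r x by rewrite /ball/= sub0r normrN gtr0_norm//; lra.
rewrite gt_eqF// => /(_ isT).
rewrite /= /GRing.scale/= mulr1 (addrC x) mulrC ltr_pdivrMr// => /ltW.
have : K' * m u <= K' * m (u + x) by rewrite ler_wpM2l// mle//; lra.
by rewrite (_ : u + x - u = x); lra.
Qed.

Lemma le_enorm {R : realType} {d : nat} (x : 'rV[R]_d) (i : 'I_d) :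
  `|x ord0 i| <= enorm x.
Proof.
rewrite -(@ler_pXn2r _ 2) ?nnegrE ?enorm_ge0// enorm_sqr real_normK ?num_real//.
by rewrite (bigD1 i)//= lerDl sumr_ge0// => j _; exact: sqr_ge0.
Qed.

(** Project the curve on the direction [w = g t - g s]. By Cauchy-Schwarz the inner product of [w]
    and [g] has derivative at most [|w|] almost everywhere, and its increment from [s] to [t] is
    [|w| ^+ 2]; hence [|w| ^+ 2 <= |w| (t - s)]. *)
Lemma arclength_curve_lipschitz {R : realType} {d : nat} (g : R -> 'rV[R]_d) :
  arclength_closed_curve g -> forall s t, enorm (g t - g s) <= `|t - s|.
Proof.
move=> [_ gL [N [mN N0 subN]]].
have [K gK] : exists K, forall x y, `|g x - g y| <= K * `|x - y|.
  have [K [_ /(_ (K + 1))]] := gL.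
  by rewrite ltrDl => /(_ ltr01) KL; exists (K + 1) => x y; exact: (KL (x, y)).
suff le_case s t : s <= t -> enorm (g t - g s) <= t - s.
  move=> s t; have [st|/ltW ts] := leP s t.
    by rewrite ger0_norm ?subr_ge0// le_case.
  by rewrite ler0_norm ?subr_le0// opprB enormB le_case.
move=> st; set w := g t - g s.
pose h x := \sum_(i < d) w ord0 i * g x ord0 i.
have hB x y : h x - h y = \sum_(i < d) w ord0 i * (g x - g y) ord0 i.
  by rewrite /h -sumrB; apply: eq_bigr => i _; rewrite !mxE mulrBr.
have hlip x y : `|h x - h y| <= (\sum_(i < d) `|w ord0 i| * K) * `|x - y|.
  rewrite hB (le_trans (ler_norm_sum _ _ _))// mulr_suml ler_sum// => i _.
  rewrite normrM -mulrA ler_wpM2l//; apply: le_trans (gK _ _).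
  rewrite [leRHS]mx_normrE.
  exact: (@le_bigmax _ _ _ 0 (fun ij => `|(g x - g y) ij.1 ij.2|) (ord0, i)).
have hder x : derivable g x 1 /\ enorm ('D_1 g x) = 1 ->
    derivable h x 1 /\ 'D_1 h x <= enorm w.
  move=> [dg Dg1].
  have dgi i : derivable (fun y => g y ord0 i) x 1 by exact: (derivable_mxP g x 1).1 dg _ _.
  have dhi i : derivable (fun y => w ord0 i * g y ord0 i) x 1.
    exact: derivableZ.
  have -> : h = \sum_(i < d) (fun y => w ord0 i * g y ord0 i).
    by apply/funext => y; rewrite /h fct_sumE.
  split; first exact: derivable_sum.
  rewrite derive_sum//.
  have -> : \sum_(i < d) 'D_1 (fun y => w ord0 i * g y ord0 i) x =
      \sum_(i < d) w ord0 i * ('D_1 g x) ord0 i.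
    apply: eq_bigr => i _.
    have -> : ('D_1 g x) ord0 i = 'D_1 (fun y => g y ord0 i) x by rewrite derive_mx// mxE.
    exact: deriveZ.
  by rewrite (le_trans (cauchy_schwarz_enorm _ _))// Dg1 mulr1.
have /(_ s t st) : forall s t, s <= t -> h t - h s <= enorm w * (t - s).
  apply: (@lipschitz_ae_derive_le _ h _ (enorm w) hlip); exists N; split => // x /= nh.
  by apply: subN => /= /hder.
rewrite hB -/w.
under eq_bigr do rewrite -expr2.
rewrite -enorm_sqr expr2.
have [->|w0] := eqVneq (enorm w) 0; first by rewrite subr_ge0.
by rewrite ler_pM2l// lt_neqAle eq_sym w0 enorm_ge0.
Qed.

(** * Distance and arcs on the circle of length 1 *)

(** [frac (t - s)] is the length of the positively oriented arc from [s] to [t] on the circle of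
    length 1. *)
Definition frac {R : realType} (x : R) : R := x - (Num.floor x)%:~R.

Section Frac.
Context {R : realType}.
Implicit Types (x y s t : R) (k : int).

Lemma frac_ge0 x : 0 <= frac x.
Proof. by rewrite subr_ge0 floor_le. Qed.

Lemma frac_lt1 x : frac x < 1.
Proof. by have /andP[_] := floor_itv x; rewrite /frac intrD; lra. Qed.

Lemma fracE x k y : 0 <= y < 1 -> x = y + k%:~R -> frac x = y.
Proof.
move=> y01 ->; rewrite /frac (@floor_def _ _ k) ?addrK// intrD.
by apply/andP; split; lra.
Qed.

Lemma frac_id x : 0 <= x < 1 -> frac x = x.
Proof. by move=> /(@fracE x 0); apply; rewrite addr0. Qed.

Lemma frac_lift x : exists k, frac x = x + k%:~R.
Proof. by exists (- Num.floor x); rewrite mulrNz. Qed.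

Lemma circle_dist1_le s t k : circle_dist 1 s t <= `|s - t + k%:~R|.
Proof.
apply: ge_inf; last by exists k => //; rewrite mulr1.
by exists 0 => _ [j _ <-].
Qed.

Lemma circle_dist1E s t :
  circle_dist 1 s t = Num.min (frac (s - t)) (1 - frac (s - t)).
Proof.
have [k vk] := frac_lift (s - t).
have v0 := frac_ge0 (s - t); have v1 := frac_lt1 (s - t).
have -> : circle_dist 1 s t = circle_dist 1 (frac (s - t)) 0.
  congr inf; apply/seteqP; split => _ [j _ <-]; rewrite !mulr1.
    by exists (j - k) => //; rewrite mulr1 intrB vk; congr `|_|; ring.
  by exists (j + k) => //; rewrite mulr1 intrD vk; congr `|_|; ring.
by rewrite circle_distE// subr0 ger0_norm// ltW.
Qed.

Lemma circle_dist1_lift s t : exists k, circle_dist 1 s t = `|s - t + k%:~R|.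
Proof.
have [k vk] := frac_lift (s - t).
have v0 := frac_ge0 (s - t); have v1 := frac_lt1 (s - t).
rewrite circle_dist1E; case: leP => _.
  by exists k; rewrite -vk ger0_norm.
by exists (k - 1); rewrite intrB addrA -vk ler0_norm; lra.
Qed.

Lemma circle_distC L s t : circle_dist L s t = circle_dist L t s.
Proof.
congr inf; apply/seteqP; split => _ [j _ <-];
  by exists (- j) => //; rewrite -normrN mulrNz; congr `|_|; ring.
Qed.

Lemma circle_dist1_ge0 s t : 0 <= circle_dist 1 s t.
Proof. by have [k ->] := circle_dist1_lift s t. Qed.

Lemma circle_dist1_le_half s t : circle_dist 1 s t <= 1 / 2.
Proof. by rewrite circle_dist1E; case: (leP (frac (s - t))) => ?; lra. Qed.

(** The integers allow arbitrary lifts, so that points of the unit square can be compared with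
    subdivision points anywhere on the line. In each direction, the lift realising one distance is
    shifted to a lift for the other. *)
Lemma circle_dist1_trans s t s' t' x y (k l : int) :
  s' = s + x + k%:~R -> t' = t + y + l%:~R ->
  `|circle_dist 1 s' t' - circle_dist 1 s t| <= `|x| + `|y|.
Proof.
move=> -> ->.
rewrite ler_norml; apply/andP; split.
  have [j ->] := circle_dist1_lift (s + x + k%:~R) (t + y + l%:~R).
  have := circle_dist1_le s t (j + k - l).
  have -> : s - t + (j + k - l)%:~R =
    (s + x + k%:~R - (t + y + l%:~R) + j%:~R) + (- x) + y.
    by rewrite !(intrD, intrB); ring.
  move=> /le_trans /(_ (ler_normD _ _)).
  have := ler_normD (s + x + k%:~R - (t + y + l%:~R) + j%:~R) (- x).
  by rewrite normrN; lra.
have [j ->] := circle_dist1_lift s t.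
have := circle_dist1_le (s + x + k%:~R) (t + y + l%:~R) (j - k + l).
have -> : s + x + k%:~R - (t + y + l%:~R) + (j - k + l)%:~R =
  (s - t + j%:~R) + x + (- y).
  by rewrite !(intrD, intrB); ring.
move=> /le_trans /(_ (ler_normD _ _)).
have := ler_normD (s - t + j%:~R) x.
by rewrite normrN; lra.
Qed.

Lemma periodicz {V : zmodType} (g : R -> V) k s :
  periodic g 1 -> g (s + k%:~R) = g s.
Proof.
move=> g1; case: (intP k) => [|n|n].
- by rewrite addr0.
- by rewrite -[RHS](periodicn g1 n.+1).
- by rewrite -[LHS](periodicn g1 n.+1) mulrNz subrK.
Qed.

(** The half-open arc running forward from [s] over length [w], given by its representatives in
    [[0, 1)]: it may split into two intervals, but products of arcs stay inside the unit square. *)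
Definition arc (s w : R) : set R := [set t | 0 <= t < 1 /\ frac (t - s) < w].

Lemma arcE s w : 0 <= w <= 1 -> arc s w =
  `[frac s, Num.min 1 (frac s + w)[ `|` `[0, frac s + w - 1[.
Proof.
move=> w01; have [k vk] := frac_lift s.
have v0 := frac_ge0 s; have v1 := frac_lt1 s.
apply/seteqP; split => [t [t01]|t] /=; rewrite ?in_itv/=.
  have [vt|tv] := leP (frac s) t.
    rewrite (@fracE _ k (t - frac s)) ?vk; [|lra|ring] => tw.
    by left; rewrite lt_min; apply/andP; split => //; lra.
  rewrite (@fracE _ (k - 1) (t - frac s + 1)) ?vk; [|lra|rewrite intrB; ring] => tw.
  by right; lra.
case=> [|ht].
  rewrite lt_min => /andP[vt /andP[t1 tw]]; split; first by lra.
  by rewrite (@fracE _ k (t - frac s)) ?vk; [lra|lra|ring].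
split; first by lra.
by rewrite (@fracE _ (k - 1) (t - frac s + 1)) ?vk; [lra|lra|rewrite intrB; ring].
Qed.

Lemma measurable_arc s w : 0 <= w <= 1 -> measurable (arc s w).
Proof. by move=> w01; rewrite arcE//; exact: measurableU. Qed.

Lemma lebesgue_measure_arc s w : 0 <= w <= 1 ->
  lebesgue_measure (arc s w) = w%:E.
Proof.
move=> w01; rewrite arcE//.
have v0 := frac_ge0 s; have v1 := frac_lt1 s.
rewrite measureU//; last first.
  apply/seteqP; split => // t [] /=; rewrite !in_itv/= => /andP[h1 h2] h3.
  by lra.
have itvE (a b : R) : lebesgue_measure (`[a, b[ : set R) = (Num.max 0 (b - a))%:E.
  rewrite lebesgue_measure_itv/= lte_fin.
  case: ltP => h; first by rewrite max_r ?EFinB//; lra.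
  by rewrite max_l//; lra.
rewrite [X in (X + _)%E]itvE [X in (_ + X)%E]itvE -EFinD; congr _%:E.
have [h|h] := leP 1 (frac s + w).
  by rewrite !max_r; lra.
by rewrite max_r ?max_l; lra.
Qed.

Lemma arc_lift s w t : arc s w t -> exists k y, [/\ 0 <= y, y < w & t = s + y + k%:~R].
Proof.
move=> [_ tw]; have [k vk] := frac_lift (t - s).
exists (- k), (frac (t - s)); split => //; first exact: frac_ge0.
by rewrite vk mulrNz; ring.
Qed.

End Frac.

(** * Measurable reciprocals and absolute continuity of the integral *)

Section Measurability.
Context {d : measure_display} {T : measurableType d} {R : realType}.

Lemma measurable_EFin_inv (D : set T) (f : T -> R) : (forall x, 0 <= f x) ->
  measurable_fun D f -> measurable_fun D (fun x => ((f x)%:E^-1)%E).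
Proof.
move=> f0 mf.
apply: (eq_measurable_fun (fun x => if f x == 0 then +oo%E else (f x `^ (-1))%:E)).
  by move=> x _; rewrite inver; case: eqP => // _; rewrite powR_inv1.
move=> mD; apply: measurable_fun_if => //.
- by apply: measurable_fun_eqr.
- apply/measurable_EFinP; apply: (measurableT_comp (measurable_powR (-1))).
  by apply: measurable_funS mf => //; exact: subIsetl.
Qed.

(** A finite integral makes [f] finite almost everywhere, so [f] may be replaced by [fine \o f], to
    which absolute continuity of the integral of a real function applies. *)
Lemma ge0_integral_small (mu : {measure set T -> \bar R}) (f : T -> \bar R) :
  measurable_fun setT f -> (forall x, (0 <= f x)%E) ->
  (\int[mu]_x f x < +oo)%E ->
  forall e : R, 0 < e -> exists2 r : R, 0 < r &
  forall A, measurable A -> (mu A < r%:E)%E -> (\int[mu]_(x in A) f x < e%:E)%E.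
Proof.
move=> mf f0 foo e e0.
have intf : mu.-integrable setT f.
  by apply/integrableP; split => //; under eq_integral => x _ do rewrite gee0_abs//.
have mff : measurable_fun setT (fine \o f) by exact: measurableT_comp.
have fE A : measurable A ->
    (\int[mu]_(x in A) f x)%E = (\int[mu]_(x in A) (`|(fine \o f) x|)%:E)%E.
  move=> mA; apply: ge0_ae_eq_integral => //.
  - exact: measurable_funTS.
  - apply/measurable_EFinP; apply: measurableT_comp => //.
    exact: measurable_funTS.
  - apply: (@filterS _ _ _ _ _ _ (integrable_ae measurableT intf)) => x /(_ I) fx _ /=.
    by rewrite -[LHS](fineK fx) ger0_norm// fine_ge0.
have intff : mu.-integrable setT (EFin \o (fine \o f)).
  apply/integrableP; split; first exact/measurable_EFinP.
  by rewrite -(fE setT).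
have [r [r0 hr]] := integral_normr_continuous intff e0.
exists r => // A mA /(hr A mA).
rewrite -lte_fin /Rintegral fineK// ?fE//.
rewrite ge0_fin_numE; last by apply: integral_ge0 => x _; rewrite lee_fin.
rewrite -fE//; apply: le_lt_trans foo.
by apply: ge0_subset_integral.
Qed.

End Measurability.

(** * The energy density *)

Section Density.
Context {R : realType} {d : nat} (g : R -> 'rV[R]_d).
Context (gp : periodic g 1).
Context (gL : forall s t, enorm (g t - g s) <= `|t - s|).

Notation mu := (@lebesgue_measure R).
Notation mu2 := (@lebesgue_measure R \x @lebesgue_measure R)%E.

Definition moebius_integrand (z : R * R) : \bar R :=
  ((enorm (g z.1 - g z.2) ^+ 2)%:E^-1 - (circle_dist 1 z.1 z.2 ^+ 2)%:E^-1)%E.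

Definition unit_square : set (R * R) := `[0, 1] `*` `[0, 1].

(* Truncating at 0 only discards the value -oo on the diagonal. *)
Definition moebius_density : R * R -> \bar R :=
  (fun z => maxe 0%E (moebius_integrand z)) \_ unit_square.

Lemma chord_le_circle_dist s t : enorm (g s - g t) <= circle_dist 1 s t.
Proof.
have [k ->] := circle_dist1_lift s t.
by rewrite -(periodicz g k s gp) (le_trans (gL _ _))// addrAC.
Qed.

Lemma measurable_unit_square : measurable unit_square.
Proof. exact: measurableX. Qed.

Lemma measurable_chord_sqr :
  measurable_fun setT (fun z : R * R => enorm (g z.1 - g z.2) ^+ 2).
Proof.
under eq_fun do rewrite enorm_sqr.
apply: measurable_sum => i; apply: measurable_funX.
have gc : continuous (fun t => g t ord0 i).
  move=> t; apply/cvgrPdist_le => e e0; near=> s.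
  have := le_enorm (g t - g s) i; rewrite !mxE => /le_trans; apply.
  by rewrite (le_trans (gL _ _))//; near: s; exact: (@cvgr_dist_le _ _ _ _ (nbhs_filter t) id t).
have mg : measurable_fun setT (fun t => g t ord0 i) by exact: continuous_measurable_fun.
under eq_fun do rewrite !mxE.
apply: measurable_funB; first exact: (measurableT_comp mg measurable_fst).
exact: (measurableT_comp mg measurable_snd).
Unshelve. all: by end_near.
Qed.

Lemma measurable_circle_dist :
  measurable_fun unit_square (fun z : R * R => circle_dist 1 z.1 z.2).
Proof.
apply: (eq_measurable_fun (fun z : R * R => Num.min `|z.1 - z.2| (1 - `|z.1 - z.2|))).
  move=> [t s]; rewrite inE => -[/=]; rewrite !in_itv/= => t01 s01.
  rewrite circle_distE// ler_norml; apply/andP; split; lra.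
apply: measurable_funTS.
have mn : measurable_fun setT (fun z : R * R => `|z.1 - z.2|).
  by apply: measurableT_comp => //; exact: measurable_funB.
by apply: measurable_minr => //; exact: measurable_funB.
Qed.

Lemma measurable_moebius_integrand : measurable_fun unit_square moebius_integrand.
Proof.
apply: emeasurable_funB; apply: measurable_EFin_inv => [z|].
- exact: sqr_ge0.
- by apply: measurable_funTS; exact: measurable_chord_sqr.
- exact: sqr_ge0.
- by apply: measurable_funX; apply measurable_circle_dist.
Qed.

Lemma measurable_moebius_density : measurable_fun setT moebius_density.
Proof.
apply/(measurable_restrictT _ measurable_unit_square).
apply: measurable_maxe => //; apply measurable_moebius_integrand.
Qed.

Lemma moebius_density_ge0 z : (0 <= moebius_density z)%E.
Proof. by apply: erestrict_ge0 => {}z _; rewrite le_max lexx. Qed.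

Lemma moebius_integrand_ge0 s t : 0 < circle_dist 1 s t ->
  (0 <= moebius_integrand (s, t))%E.
Proof.
move=> st0; rewrite /moebius_integrand /= !inver.
have st2 : 0 < circle_dist 1 s t ^+ 2 by rewrite exprn_gt0.
rewrite (gt_eqF st2); case: eqP => [_|/eqP c0]; first by rewrite sube_ge0// leey.
rewrite -EFinB lee_fin subr_ge0 lef_pV2 ?posrE//.
  by rewrite ler_pXn2r ?nnegrE ?enorm_ge0 ?(ltW st0)// chord_le_circle_dist.
by rewrite lt_neqAle eq_sym c0 sqr_ge0.
Qed.

Lemma moebius_integrand_diag s t : circle_dist 1 s t = 0 ->
  maxe 0%E (moebius_integrand (s, t)) = 0%E.
Proof.
by move=> st0; rewrite /moebius_integrand/= st0 expr0n/= inve0 addeNy max_l// leNye.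
Qed.

(** Tonelli turns the iterated integral into one over the product. For fixed [t] the truncation
    matters only at points at distance 0 from [t]; these lie in [{t, 0, 1}], as 0 and 1 are the same
    point of the circle. *)
Lemma moebius_energyE : moebius_energy g = (\int[mu2]_z moebius_density z)%E.
Proof.
have /= -> := @fubini_tonelli1 _ _ _ _ R mu mu _ measurable_moebius_density moebius_density_ge0.
rewrite /moebius_energy integral_mkcond; apply: eq_integral => t _.
rewrite /fubini_F patchE; case: ifPn => [|tn]; last first.
  rewrite (eq_integral (cst 0%E)) ?integral0// => s _.
  rewrite /moebius_density patchE ifN// notin_setE => -[/= tI _].
  by move: tn; rewrite notin_setE.
rewrite inE => tI.
transitivity (\int[mu]_(s in `[0%R, 1%R]) maxe 0%E (moebius_integrand (t, s)))%E; last first.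
  rewrite [LHS]integral_mkcond. apply: eq_integral => s _.
  rewrite /moebius_density !patchE; congr (if _ then _ else _).
  by apply/idP/idP; rewrite !inE => // -[].
have mI : measurable_fun (`[0, 1] : set R) (fun s => moebius_integrand (t, s)).
  apply: (measurable_comp measurable_unit_square _ measurable_moebius_integrand).
    by move=> _ [s sI <-].
  exact: measurable_funTS.
apply: ae_eq_integral => //; first exact: measurable_maxe.
exists ([set t] `|` [set 0] `|` [set 1]); split.
- by apply: measurableU => //; exact: measurableU.
- by apply/countable_lebesgue_measure0/finite_set_countable; rewrite !finite_setU.
move=> s /= /not_implyP[sI].
apply: contra_notP => /not_orP[/not_orP[st s0] s1].
rewrite max_r// moebius_integrand_ge0//.
move: tI sI st s0 s1; rewrite /= !in_itv/= => tI sI /eqP st /eqP s0 /eqP s1.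
rewrite circle_distE//; last by rewrite ler_norml; apply/andP; split; lra.
rewrite lt_min normr_gt0 subr_eq0 eq_sym st/= subr_gt0 ltr_norml.
apply/andP; split; last by move: s0 s1; rewrite !neq_lt; lra.
by move: s0 s1; rewrite !neq_lt; lra.
Qed.

End Density.

(** * Consequences of finite energy *)

Section FiniteEnergy.
Context {R : realType} {d : nat} (g : R -> 'rV[R]_d).
Context (gp : periodic g 1).
Context (gL : forall s t, enorm (g t - g s) <= `|t - s|).
Context (Efin : (moebius_energy g < +oo)%E).

Notation mu := (@lebesgue_measure R).
Notation mu2 := (@lebesgue_measure R \x @lebesgue_measure R)%E.
Notation dens := (moebius_density g).
Notation chord s t := (enorm (g s - g t)).

Lemma moebius_density_lb s t x y : unit_square (s, t) -> 0 < x -> 0 < y ->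
  chord s t <= x -> y <= circle_dist 1 s t ->
  ((x ^- 2 - y ^- 2)%:E <= dens (s, t))%E.
Proof.
move=> Qst x0 y0 cx yd; rewrite /moebius_density patchE mem_set//.
have d0 : 0 < circle_dist 1 s t by exact: lt_le_trans yd.
rewrite max_r ?moebius_integrand_ge0// /moebius_integrand/= !inver.
rewrite (gt_eqF (exprn_gt0 _ d0)); case: ifPn => [_|c0]; first exact: leey.
have {}c0 : 0 < chord s t.
  by rewrite lt_neqAle enorm_ge0 andbT eq_sym; move: c0; rewrite sqrf_eq0.
by rewrite -EFinB lee_fin lerB// lef_pV2 ?posrE ?exprn_gt0// ler_pXn2r ?nnegrE// ltW.
Qed.

Lemma moebius_density_ub s t x y : unit_square (s, t) -> 0 < x ->
  x <= chord s t -> circle_dist 1 s t <= y ->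
  (dens (s, t) <= (x ^- 2 - y ^- 2)%:E)%E.
Proof.
move=> Qst x0 xc dy; rewrite /moebius_density patchE mem_set//.
have c0 : 0 < chord s t by exact: lt_le_trans xc.
have d0 : 0 < circle_dist 1 s t by exact: (lt_le_trans c0 (chord_le_circle_dist _ gp gL _ _)).
rewrite max_r ?moebius_integrand_ge0// /moebius_integrand/= !inver.
rewrite (gt_eqF (exprn_gt0 _ d0)) (gt_eqF (exprn_gt0 _ c0)).
have y0 : 0 < y by exact: lt_le_trans dy.
by rewrite -EFinB lee_fin lerB// lef_pV2 ?posrE ?exprn_gt0// ler_pXn2r ?nnegrE// ltW.
Qed.

Lemma arc_square (s u t w : R) z : (arc s u `*` arc t w) z -> unit_square z.
Proof.
by case: z => x y [[/= x01 _] [/= y01 _]]; split; rewrite /= in_itv/=; lra.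
Qed.

Lemma measurable_arcX (s u t w : R) : 0 <= u <= 1 -> 0 <= w <= 1 ->
  measurable (arc s u `*` arc t w : set (R * R)).
Proof. by move=> u01 w01; apply: measurableX; apply: measurable_arc. Qed.

Lemma lebesgue_measure_arcX (s u t w : R) : 0 <= u <= 1 -> 0 <= w <= 1 ->
  mu2 (arc s u `*` arc t w) = (u * w)%:E.
Proof.
move=> u01 w01; rewrite [LHS]product_measure1E; [|exact: measurable_arc..].
by rewrite [X in (X * _)%E]lebesgue_measure_arc// [X in (_ * X)%E]lebesgue_measure_arc.
Qed.

Let mdens (A : set (R * R)) : measurable_fun A dens.
Proof. by apply: measurable_funTS; exact: measurable_moebius_density. Qed.

Lemma moebius_density_small (e : R) : 0 < e -> exists2 r : R, 0 < r &
  forall A, measurable A -> (mu2 A < r%:E)%E -> (\int[mu2]_(x in A) dens x < e%:E)%E.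
Proof.
apply: ge0_integral_small.
- exact: measurable_moebius_density.
- exact: moebius_density_ge0.
- by rewrite -moebius_energyE.
Qed.

Lemma moebius_mass_lb (s u t w lo : R) : 0 <= u <= 1 -> 0 <= w <= 1 ->
  (forall z, (arc s u `*` arc t w) z -> (lo%:E <= dens z)%E) ->
  ((lo * (u * w))%:E <= \int[mu2]_(z in arc s u `*` arc t w) dens z)%E.
Proof.
move=> u01 w01 lo_dens; have mA := measurable_arcX s u t w u01 w01.
have [lo0|lo0] := leP 0 lo; last first.
  apply: (@le_trans _ _ 0%E); last by apply: integral_ge0 => z _; exact: moebius_density_ge0.
  by rewrite lee_fin nmulr_rle0// mulr_ge0; lra.
rewrite EFinM -(lebesgue_measure_arcX s u t w)// -integral_cst//.
by apply: ge0_le_integral => //; apply mdens.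
Qed.

Lemma moebius_mass_ub (s u t w hi : R) : 0 <= u <= 1 -> 0 <= w <= 1 ->
  (forall z, (arc s u `*` arc t w) z -> (dens z <= hi%:E)%E) ->
  (\int[mu2]_(z in arc s u `*` arc t w) dens z <= (hi * (u * w))%:E)%E.
Proof.
move=> u01 w01 hi_dens; have mA := measurable_arcX s u t w u01 w01.
rewrite EFinM -(lebesgue_measure_arcX s u t w)// -integral_cst//.
apply: ge0_le_integral => //; [|by apply mdens].
by move=> z _; exact: moebius_density_ge0.
Qed.

(** Suppose the chord is at most [r <= D / 12]. For points on the arcs of length [r] from [s] and
    [t], chords are at most [3 r] and distances at least [D - 2 r >= 6 r], so the energy of this
    square is at least [((3 r) ^- 2 - (6 r) ^- 2) r ^+ 2 = 1 / 12]. Squares of small area have less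
    energy than that. *)
Lemma bilipschitz : exists2 k : R, 0 < k <= 1 &
  forall s t, k * circle_dist 1 s t <= chord s t.
Proof.
have [r0 r00 small] : exists2 r : R, 0 < r & forall A, measurable A ->
    (mu2 A < r%:E)%E -> (\int[mu2]_(x in A) dens x < (1 / 12)%:E)%E.
  by apply: moebius_density_small; lra.
(* The bound [1 / 24] gives [min q (D / 12) >= 2 q D] for [D <= 1 / 2]; the bound [r0 / 2] keeps the
   area [r ^+ 2] below [r0]. *)
pose q := Num.min (1 / 24) (r0 / 2).
have q0 : 0 < q by rewrite lt_min; apply/andP; split; lra.
have q1 : q <= 1 / 24 by rewrite ge_min lexx.
have q2 : q <= r0 / 2 by rewrite ge_min lexx orbT.
exists (2 * q); first lra.
move=> s t; set D := circle_dist 1 s t.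
have [D0|D0] := leP D 0.
  by apply: le_trans (enorm_ge0 _); rewrite pmulr_rle0//; lra.
have D1 : D <= 1 / 2 by exact: circle_dist1_le_half.
pose r := Num.min q (D / 12).
have rp : 0 < r by rewrite lt_min q0/= divr_gt0.
have rq : r <= q by rewrite ge_min lexx.
have rD : r <= D / 12 by rewrite ge_min lexx orbT.
have [cr|rc] := leP (chord s t) r; last first.
  apply: le_trans (ltW rc); rewrite le_min; apply/andP; split; nra.
suff : ((1 / 12)%:E <= \int[mu2]_(x in arc s r `*` arc t r) dens x)%E.
  rewrite leNgt => /negP[]; apply: small.
    by apply: measurable_arcX; lra.
  by rewrite lebesgue_measure_arcX ?lte_fin; [nra|lra|lra].
have -> : 1 / 12 = ((3 * r) ^- 2 - (6 * r) ^- 2) * (r * r).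
  by field; rewrite gt_eqF.
apply: moebius_mass_lb; [lra|lra|] => -[s' t'] Az.
have [/= /arc_lift[k [x [x0 xr s'E]]] /arc_lift[l [y [y0 yr t'E]]]] := Az.
apply: moebius_density_lb; [exact: arc_square Az|lra|lra|..].
  rewrite s'E t'E !periodicz//.
  have := enorm_triangle (g (s + x)) (g s) (g (t + y)).
  have := enorm_triangle (g s) (g t) (g (t + y)).
  have := gL s (s + x); have := gL (t + y) t.
  rewrite addrAC subrr add0r (ger0_norm x0) opprD addrA subrr add0r normrN (ger0_norm y0).
  lra.
have := circle_dist1_trans s t s' t' x y k l s'E t'E.
rewrite (ger0_norm x0) (ger0_norm y0) ler_norml -/D => /andP[h1 h2].
lra.
Qed.

Definition strip (e : R) : set (R * R) :=
  unit_square `&` [set z | circle_dist 1 z.1 z.2 <= e].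

Lemma measurable_strip e : measurable (strip e).
Proof.
have := @measurable_circle_dist R measurable_unit_square `]-oo, e]%classic (measurable_itv _).
by congr (measurable (_ `&` _)); apply/seteqP; split => z /=; rewrite in_itv.
Qed.

(** Dominated convergence, with the density itself as dominating function: the strips shrink to the
    points at distance 0, where the truncated density vanishes. *)
Lemma moebius_strip_small (e : R) : 0 < e -> exists2 r : R, 0 < r <= 1 / 4 &
  (\int[mu2]_(z in strip r) dens z < e%:E)%E.
Proof.
move=> e0.
have intd : mu2.-integrable setT dens.
  apply/integrableP; split; first exact: mdens.
  by under eq_integral => z _ do rewrite gee0_abs ?moebius_density_ge0//;
    rewrite -moebius_energyE.
pose f n := dens \_ (strip n.+1%:R^-1).
have f_cvg0 z : f ^~ z @ \oo --> 0%E.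
  have [d0|dz] := eqVneq (dens z) 0%E.
    rewrite (_ : f ^~ z = cst 0%E); first exact: cvg_cst.
    by apply/funext => n; rewrite /f patchE d0 if_same.
  have D0 : 0 < circle_dist 1 z.1 z.2.
    rewrite lt_neqAle circle_dist1_ge0 andbT; apply: contraNneq dz => D0.
    rewrite /moebius_density patchE; case: ifPn => // _.
    by case: z D0 => z1 z2 /esym/(moebius_integrand_diag g) ->.
  have := near_infty_natSinv_lt (PosNum D0) => near_lt.
  apply: cvg_near_cst; near=> n; rewrite /f patchE ifN// notin_setE => -[_ /=].
  rewrite leNgt => /negP; apply; near: n; exact: near_lt.
have [||||| _ _] := @dominated_convergence _ _ _ mu2 setT measurableT f (cst 0%E) dens.
- by move=> n; apply/(measurable_restrictT _ (measurable_strip _)); exact: mdens.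
- exact: measurable_cst.
- by apply: aeW => z _; exact: f_cvg0.
- exact: intd.
- apply: aeW => z n _; rewrite /f patchE; case: ifPn => _.
    by rewrite gee0_abs// moebius_density_ge0.
  by rewrite abse0 moebius_density_ge0.
rewrite integral_cst// mul0e => cvg_int.
have /cvg_int : nbhs (0%E : \bar R) [set x | (x < e%:E)%E].
  by apply: open_nbhs_nbhs; split; [exact: open_ereal_lt_ereal|rewrite /= lte_fin].
move=> [N _ hN]; pose n := maxn N 3.
exists n.+1%:R^-1.
  rewrite invr_gt0 ltr0n/= div1r lef_pV2 ?posrE ?ltr0n// (ler_nat _ 4).
  by rewrite ltnS leq_maxr.
have := hN n (leq_maxl _ _).
by rewrite /= /f -integral_mkcond.
Unshelve. all: by end_near.
Qed.

End FiniteEnergy.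

(** * Subdivisions *)

Section Subdivision.
Context {R : realType} {n : nat} (L : R) (b : 'I_n -> R).
Context (sb : subdivision L b).

Definition gap (i : 'I_n) : R := next_lift L b i - b i.

Lemma ordS_lt (i : 'I_n) : i.+1 != n -> ordS i = i.+1 :> nat.
Proof. by move=> iN; rewrite /= modn_small// ltn_neqAle iN ltn_ord. Qed.

Lemma ordS_last (i : 'I_n) : i.+1 = n -> ordS i = 0 :> nat.
Proof. by move=> iN; rewrite /= iN modnn. Qed.

Lemma subdivision_le (i j : 'I_n) : (i <= j)%N -> b i <= b j.
Proof.
rewrite leq_eqVlt => /orP[/eqP/val_inj -> //|ij].
exact/ltW/(sb.1 _ _ ij).
Qed.

Lemma gap_gt0 i : 0 < gap i.
Proof.
rewrite /gap subr_gt0 /next_lift; case: ifPn => iN; first exact: sb.2.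
by apply: sb.1; rewrite ordS_lt.
Qed.

Lemma gap_le_forward (i j : 'I_n) : (i < j)%N -> gap i <= b j - b i.
Proof.
move=> ij; have iN : i.+1 != n by rewrite ltn_eqF// (leq_ltn_trans ij).
by rewrite /gap /next_lift (negbTE iN) lerD2r subdivision_le// ordS_lt.
Qed.

Lemma gap_le_backward (i j : 'I_n) : (j <= i)%N -> gap i <= b j + L - b i.
Proof.
move=> ji; rewrite /gap lerD2r /next_lift; case: ifPn => iN; last exact/ltW/sb.2.
by rewrite lerD2r subdivision_le// ordS_last//; exact/eqP.
Qed.

End Subdivision.

Lemma ord_nondecreasing {R : realType} {n : nat} (u : 'I_n -> R) :
  (forall i : 'I_n, i.+1 != n -> u i <= u (ordS i)) ->
  forall i j : 'I_n, (i <= j)%N -> u i <= u j.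
Proof.
move=> uS i [j jn]; elim: j jn => [|j IH] jn /=.
  by rewrite leqn0 => /eqP i0; rewrite (_ : i = Ordinal jn)//; exact: val_inj.
rewrite leq_eqVlt => /orP[/eqP ij|]; first by rewrite (_ : i = Ordinal jn)//; exact: val_inj.
rewrite ltnS => ij; have jn' := ltnW jn.
apply: (le_trans (IH jn' ij)).
have jN : (Ordinal jn').+1 != n by rewrite ltn_eqF.
rewrite (_ : Ordinal jn = ordS (Ordinal jn')); first exact: uS.
by apply: val_inj; rewrite /= modn_small.
Qed.

(** The differences cancel around the cycle, and only the shift by [L] in the closing gap
    survives. *)
Lemma sum_gap {R : realType} {n : nat} (L : R) (b : 'I_n -> R) : (0 < n)%N ->
  \sum_i gap L b i = L.
Proof.
case: n b => // n b _.
have -> : \sum_i gap L b i = \sum_(i < n.+1) (b (ordS i) - b i) +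
    \sum_(i < n.+1) (if i.+1 == n.+1 then L else 0).
  rewrite -big_split/=; apply: eq_bigr => i _; rewrite /gap /next_lift.
  by case: ifP => _; ring.
rewrite sumrB [X in X - _ + _](_ : _ = \sum_i b i); last first.
  by rewrite [RHS](reindex_inj (@ordS_inj n.+1)).
rewrite subrr add0r (bigD1 ord_max)//= eqxx big1 ?addr0// => i /eqP iN.
by case: eqP => // -[iE]; case: iN; exact: val_inj.
Qed.

(** * Partition of the circle into the arcs of a subdivision *)

Section CircleSubdivision.
Context {R : realType} {n : nat} (b : 'I_n -> R).
Context (sb : subdivision 1 b).

Lemma gap_le1 i : gap 1 b i <= 1.
Proof. by have := gap_le_backward 1 b sb i i (leqnn _); lra. Qed.

Lemma gap_itv i : 0 <= gap 1 b i <= 1.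
Proof. by rewrite (ltW (gap_gt0 _ _ sb _)) gap_le1. Qed.

Lemma next_lift_congr i : exists k : int, b (ordS i) = b i + gap 1 b i + k%:~R.
Proof.
rewrite /gap /next_lift; case: ifP => _; last by exists 0; lra.
by exists (-1); rewrite mulrNz; lra.
Qed.

(** Running forward from [b i], the first subdivision point met is its cyclic successor. *)
Lemma gap_le_frac i j : i != j -> gap 1 b i <= frac (b j - b i).
Proof.
move=> ij; have [ltij|ltji|/val_inj/eqP] := ltngtP i j; last by rewrite (negbTE ij).
- rewrite frac_id; first exact: gap_le_forward.
  by have := sb.1 _ _ ltij; have := sb.2 i j; lra.
- rewrite (@fracE _ _ (-1) (b j + 1 - b i)); first exact: (gap_le_backward _ _ sb _ _ (ltnW ltji)).
    by have := sb.1 _ _ ltji; have := sb.2 j i; lra.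
  by rewrite mulrNz; lra.
Qed.

Lemma frac_opp (x : R) : frac x != 0 -> frac (- x) = 1 - frac x.
Proof.
move=> x0; have [k xk] := frac_lift x.
have v0 := frac_ge0 x; have v1 := frac_lt1 x.
apply: (@fracE _ _ (k - 1)); last by rewrite intrB xk; lra.
have : 0 < frac x by rewrite lt_neqAle eq_sym x0.
by lra.
Qed.

(** If [i != j], the way forward from [b i] to [t] passes [b j]: the remaining arc from [b j] back
    to [b i] has length at least [gap 1 b j]. Its length is then at least
    [frac (b j - b i) >= gap 1 b i], so [t] is outside the first arc. *)
Lemma cell_uniq i j t : arc (b i) (gap 1 b i) t -> arc (b j) (gap 1 b j) t -> i = j.
Proof.
move=> [_ ti] [_ tj]; apply/eqP/negPn/negP => ij.
have v := gap_le_frac _ _ ij; rewrite eq_sym in ij; have := gap_le_frac _ _ ij.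
rewrite -(opprB (b j)) frac_opp => [v'|]; last first.
  by rewrite gt_eqF//; exact: lt_le_trans (gap_gt0 _ _ sb _) v.
have [k kE] := frac_lift (b j - b i).
have [l lE] := frac_lift (t - b j).
have v0 := frac_ge0 (b j - b i).
have y0 := frac_ge0 (t - b j).
suff : frac (t - b i) = frac (b j - b i) + frac (t - b j) by lra.
by apply: (@fracE _ _ (- k - l)); [lra|rewrite intrB mulrNz kE lE; lra].
Qed.

(** Take the subdivision point closest behind [t]; if [t] were beyond its arc, the successor would
    be closer. *)
Lemma cell_cover t : (0 < n)%N -> 0 <= t < 1 -> exists i, arc (b i) (gap 1 b i) t.
Proof.
move=> n0 t01; pose i0 := Ordinal n0.
pose i := [arg min_(i < i0) frac (t - b i)]%O.
have imin j : frac (t - b i) <= frac (t - b j).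
  by rewrite /i; case: arg_minP => // k _; exact.
exists i; split => //; rewrite ltNge; apply/negP => gi.
have [k kE] := next_lift_congr i.
have [l lE] := frac_lift (t - b i).
have g0 := gap_gt0 _ _ sb i.
have x1 := frac_lt1 (t - b i).
have := imin (ordS i).
rewrite (@fracE _ (t - b (ordS i)) (- l - k) (frac (t - b i) - gap 1 b i)).
- by lra.
- by lra.
- by rewrite kE intrB mulrNz lE; lra.
Qed.

End CircleSubdivision.

(** * Decomposition of the energy into the energies of the cells *)

Section CellMass.
Context {R : realType} {d : nat} (g : R -> 'rV[R]_d).
Context (gp : periodic g 1).
Context (gL : forall s t, enorm (g t - g s) <= `|t - s|).
Context (Efin : (moebius_energy g < +oo)%E).
Context {n : nat} (n0 : (0 < n)%N) (b : 'I_n -> R) (sb : subdivision 1 b).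

Notation mu2 := (@lebesgue_measure R \x @lebesgue_measure R)%E.
Notation dens := (moebius_density g).

Definition cell (ij : 'I_n * 'I_n) : set (R * R) :=
  arc (b ij.1) (gap 1 b ij.1) `*` arc (b ij.2) (gap 1 b ij.2).

Definition cell_mass (ij : 'I_n * 'I_n) : R :=
  fine (\int[mu2]_(z in cell ij) dens z)%E.

Lemma measurable_cell ij : measurable (cell ij).
Proof. by apply: measurable_arcX; exact: gap_itv. Qed.

Lemma moebius_mass_fin A : measurable A -> (\int[mu2]_(z in A) dens z)%E \is a fin_num.
Proof.
move=> mA; rewrite ge0_fin_numE; last by apply: integral_ge0 => z _; exact: moebius_density_ge0.
apply: le_lt_trans Efin; rewrite moebius_energyE//.
apply: ge0_subset_integral => //; first exact: measurable_moebius_density.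
by move=> z _; exact: moebius_density_ge0.
Qed.

Lemma cell_massE ij : (cell_mass ij)%:E = (\int[mu2]_(z in cell ij) dens z)%E.
Proof. by rewrite fineK// moebius_mass_fin//; exact: measurable_cell. Qed.

Lemma cell_mass_ge0 ij : 0 <= cell_mass ij.
Proof. by rewrite fine_ge0// integral_ge0// => z _; exact: moebius_density_ge0. Qed.

Lemma trivIset_cell (D : set ('I_n * 'I_n)) : trivIset D cell.
Proof.
move=> [i j] [k l] _ _ [[x y] [[/= xi yj] [/= xk yl]]].
by rewrite (cell_uniq b sb _ _ _ xi xk) (cell_uniq b sb _ _ _ yj yl).
Qed.

Lemma sum_cell_massE (P : pred ('I_n * 'I_n)) :
  (\sum_(ij | P ij) cell_mass ij)%:E =
  (\int[mu2]_(z in \big[setU/set0]_(ij | P ij) cell ij) dens z)%E.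
Proof.
rewrite -sumEFin (eq_bigr _ (fun ij _ => cell_massE ij)).
rewrite -big_filter -[in RHS]big_filter ge0_integral_bigsetU//.
- exact: measurable_cell.
- by rewrite filter_uniq// index_enum_uniq.
- exact: trivIset_cell.
- by apply: measurable_funTS; apply measurable_moebius_density.
- by move=> z _; exact: moebius_density_ge0.
Qed.

Lemma sum_cell_mass_le (P : pred ('I_n * 'I_n)) S : measurable S ->
  (forall ij, P ij -> cell ij `<=` S) ->
  ((\sum_(ij | P ij) cell_mass ij)%:E <= \int[mu2]_(z in S) dens z)%E.
Proof.
move=> mS PS; rewrite sum_cell_massE; apply: ge0_subset_integral => //.
- by apply: bigsetU_measurable => ij _; exact: measurable_cell.
- by apply: measurable_funTS; apply measurable_moebius_density.
- by move=> z _; exact: moebius_density_ge0.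
- by elim/big_ind: _ => // A B AS BS z []; [exact: AS|exact: BS].
Qed.

(** The disjoint cells cover [[0, 1)] times itself; what they miss of the closed square lies on two
    of its sides, a null set. *)
Lemma sum_cell_mass : (\sum_ij cell_mass ij)%:E = moebius_energy g.
Proof.
rewrite sum_cell_massE moebius_energyE//.
set U := \big[_/_]_ij _.
have mU : measurable U by apply: bigsetU_measurable => ij _; exact: measurable_cell.
have md A : measurable_fun A dens.
  by apply: measurable_funTS; apply measurable_moebius_density.
rewrite -[in RHS](setUv U) ge0_integral_setU//; last first.
- by rewrite disj_set2E setICr.
- by move=> z _; exact: moebius_density_ge0.
- exact: md.
- exact: measurableC.
rewrite [X in (_ + X)%E](_ : _ = 0%E) ?adde0//.
pose N : set (R * R) := ([set 1] `*` `[0, 1]) `|` (`[0, 1] `*` [set 1]).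
have mN : measurable N by apply: measurableU; apply: measurableX.
rewrite integral_mkcond.
have -> : dens \_ (~` U) = dens \_ (~` U `&` N).
  apply/funext => -[s t]; rewrite !patchE in_setI.
  case: ifPn => //= /set_mem nU; case: ifPn => // /negP; rewrite inE => nN.
  rewrite /moebius_density patchE; case: ifPn => // /set_mem [/=].
  rewrite !in_itv/= => s01 t01; exfalso; apply: nN; apply: contrapT => nN.
  have s1 : s < 1.
    rewrite lt_neqAle (andP s01).2 andbT; apply/eqP => s1; apply: nN; left.
    by split => //=; rewrite in_itv.
  have t1 : t < 1.
    rewrite lt_neqAle (andP t01).2 andbT; apply/eqP => t1; apply: nN; right.
    by split => //=; rewrite in_itv.
  have [i si] := cell_cover b sb s n0 (ltac:(lra)).
  have [j tj] := cell_cover b sb t n0 (ltac:(lra)).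
  by apply: nU; rewrite /U (bigD1 (i, j))//=; left.
rewrite -integral_mkcond; apply: null_set_integral; [|exact: md|].
- by apply: measurableI => //; exact: measurableC.
- suff N0 : mu2 N = 0%E.
    apply/eqP; rewrite eq_le measure_ge0 andbT -N0; apply: le_measure; rewrite ?inE//.
    by apply: measurableI => //; exact: measurableC.
  have mX1 : measurable ([set 1] `*` `[0, 1] : set (R * R)) by exact: measurableX.
  have mX2 : measurable (`[0, 1] `*` [set 1] : set (R * R)) by exact: measurableX.
  have X1 : mu2 ([set 1] `*` `[0, 1]) = 0%E.
    by rewrite [LHS]product_measure1E// [X in (X * _)%E]lebesgue_measure_set1 mul0e.
  have X2 : mu2 (`[0, 1] `*` [set 1]) = 0%E.
    by rewrite [LHS]product_measure1E// [X in (_ * X)%E]lebesgue_measure_set1 mule0.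
  by rewrite /N [LHS]measureU0.
Qed.

End CellMass.

(** * Inscribed polygons *)

Section InscribedPolygon.
Context {R : realType} {d : nat} (g : R -> 'rV[R]_d).
Context (gp : periodic g 1).
Context (gL : forall s t, enorm (g t - g s) <= `|t - s|).
Context {n : nat} (n0 : (0 < n)%N) (b : 'I_n -> R) (sb : subdivision 1 b).
Context (L : R) (a : 'I_n -> R) (sa : subdivision L a).
Context (edge : forall i, enorm (g (b (ordS i)) - g (b i)) = gap L a i).

Lemma edge_le_gap i : gap L a i <= gap 1 b i.
Proof.
have [k bS] := next_lift_congr b i.
rewrite -edge bS periodicz// (le_trans (gL _ _))// addrAC subrr add0r.
by rewrite ger0_norm// ltW// gap_gt0.
Qed.

Lemma polygon_length_le1 : L <= 1.
Proof.
rewrite -(sum_gap L a n0) -(sum_gap 1 b n0).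
by apply: ler_sum => i _; exact: edge_le_gap.
Qed.

(** Each edge is at most its gap, so [b k - a k] is nondecreasing in [k]; its growth around the
    whole cycle, closing edge included, is [1 - L]. *)
Lemma param_increment (i j : 'I_n) : (i <= j)%N ->
  0 <= (b j - b i) - (a j - a i) <= 1 - L.
Proof.
move=> ij; pose u k := b k - a k.
have uS (k : 'I_n) : k.+1 != n -> u k <= u (ordS k).
  move=> kN; have := edge_le_gap k.
  by rewrite /gap /next_lift (negbTE kN) /u; lra.
have umono := ord_nondecreasing u uS.
have uij := umono i j ij.
have lastP : (n.-1 < n)%N by rewrite prednK.
pose l := Ordinal lastP; pose z := Ordinal n0.
have ul : u j <= u l by apply: umono; rewrite /= -ltnS prednK.
have uz : u z <= u i by apply: umono.
have lN : l.+1 == n by rewrite /= prednK.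
have lz : ordS l = z by apply: val_inj => /=; rewrite prednK// modnn.
have := edge_le_gap l; rewrite /gap /next_lift lN lz.
by rewrite /u in uij ul uz; lra.
Qed.

Lemma chord_le_param (i j : 'I_n) : (i <= j)%N ->
  enorm (g (b j) - g (b i)) <= a j - a i.
Proof.
case: j => k kn /=; elim: k kn => [|k IH] kn.
  rewrite leqn0 => /eqP i0; rewrite (_ : Ordinal kn = i); last exact: val_inj.
  by rewrite !subrr enorm0.
rewrite leq_eqVlt => /orP[/eqP ik|].
  rewrite (_ : Ordinal kn = i); last exact: val_inj.
  by rewrite !subrr enorm0.
rewrite ltnS => /(IH (ltnW kn)) {}IH.
set k' := Ordinal (ltnW kn) in IH.
have kS : Ordinal kn = ordS k' by apply: val_inj; rewrite /= modn_small.
have kN : k'.+1 != n by rewrite /= ltn_eqF.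
rewrite kS; have := enorm_triangle (g (b (ordS k'))) (g (b k')) (g (b i)).
by rewrite edge /gap /next_lift (negbTE kN); lra.
Qed.

(** The polygonal path from [j] to [i] through the closing edge has length [L - (a j - a i)]. *)
Lemma chord_le_param_backward (i j : 'I_n) : (i <= j)%N ->
  enorm (g (b j) - g (b i)) <= L - (a j - a i).
Proof.
move=> ij.
have lastP : (n.-1 < n)%N by rewrite prednK.
pose l := Ordinal lastP; pose z := Ordinal n0.
have lN : l.+1 == n by rewrite /= prednK.
have lz : ordS l = z by apply: val_inj => /=; rewrite prednK// modnn.
have jl : (j <= l)%N by rewrite /= -ltnS prednK.
have h1 := chord_le_param _ _ jl.
have h2 := chord_le_param z i (leq0n _).
have := edge l; rewrite /gap /next_lift lN lz => h3.
have t1 := enorm_triangle (g (b j)) (g (b l)) (g (b i)).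
have t2 := enorm_triangle (g (b l)) (g (b z)) (g (b i)).
rewrite enormB in h1; rewrite enormB in h2; rewrite enormB in h3.
lra.
Qed.

(** By [param_increment], each of the two arcs between the points is at most [1 - L] shorter on the
    polygon than on the curve, and never longer; take minima. Each polygonal arc is at least the
    chord. *)
Lemma polygon_dist_cmp (i j : 'I_n) : i != j ->
  [/\ 0 < circle_dist L (a j) (a i),
      enorm (g (b j) - g (b i)) <= circle_dist L (a j) (a i),
      circle_dist L (a j) (a i) <= circle_dist 1 (b j) (b i) &
      circle_dist 1 (b j) (b i) <= circle_dist L (a j) (a i) + (1 - L)].
Proof.
wlog ij : i j / (i < j)%N => [wlg|_].
  move=> ij; have [ltij|ltji|/val_inj/eqP] := ltngtP i j; last by rewrite (negbTE ij).
    exact: wlg.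
  rewrite circle_distC (circle_distC 1) enormB; apply: wlg => //.
  by rewrite eq_sym.
have aij := sa.1 _ _ ij; have bij := sb.1 _ _ ij.
have aL := sa.2 i j; have bL := sb.2 i j.
have L0 : 0 < L by lra.
have an : `|a j - a i| = a j - a i by rewrite ger0_norm; lra.
have bn : `|b j - b i| = b j - b i by rewrite ger0_norm; lra.
rewrite (circle_distE L0) ?an; last by lra.
rewrite (circle_distE (ltr01 : 0 < (1 : R))) ?bn; last by lra.
have h := param_increment _ _ (ltnW ij).
have c1 := chord_le_param _ _ (ltnW ij).
have c2 := chord_le_param_backward _ _ (ltnW ij).
split.
- by rewrite lt_min; apply/andP; split; lra.
- by rewrite le_min c1 c2.
- rewrite le_min !ge_min; apply/andP; split; apply/orP; [left|right]; lra.
- by rewrite -lerBlDr le_min !lerBlDr !ge_min; apply/andP; split; apply/orP; [left|right]; lra.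
Qed.

End InscribedPolygon.

(** On [z >= m] the slope of [z ^- 2] is at most [2 / m ^+ 3] in absolute value. *)
Lemma invsq_le {R : realType} (m x y r : R) : 0 < m -> m <= x -> m <= y ->
  0 <= r -> y <= x + r -> x ^- 2 <= y ^- 2 + 2 / m ^+ 3 * r.
Proof.
move=> m0 mx my r0 yxr; have x0 : 0 < x by lra. have y0 : 0 < y by lra.
have m30 : 0 < m ^+ 3 by rewrite exprn_gt0.
have [yx|xy] := leP y x.
  have : x ^- 2 <= y ^- 2.
    by rewrite lef_pV2 ?posrE ?exprn_gt0// ler_pXn2r ?nnegrE// ltW.
  have : 0 <= 2 / m ^+ 3 * r by rewrite mulr_ge0// divr_ge0// ltW.
  lra.
rewrite -lerBlDl.
have -> : x ^- 2 - y ^- 2 = (y - x) * ((x * y ^+ 2)^-1 + (x ^+ 2 * y)^-1).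
  by field; rewrite !gt_eqF.
rewrite [leRHS]mulrC; apply: ler_pM; [lra|by rewrite addr_ge0// invr_ge0 mulr_ge0 ?sqr_ge0// ltW|lra|].
have -> : 2 / m ^+ 3 = (m ^+ 3)^-1 + (m ^+ 3)^-1 by field; rewrite gt_eqF.
have lesq z : m <= z -> m ^+ 2 <= z ^+ 2.
  by move=> mz; rewrite ler_pXn2r ?nnegrE//; lra.
apply: lerD; rewrite lef_pV2 ?posrE ?mulr_gt0 ?exprn_gt0//.
  by rewrite exprS ler_pM ?sqr_ge0 ?lesq// ltW.
by rewrite exprSr ler_pM ?sqr_ge0 ?lesq// ltW.
Qed.

Lemma ordS_neq {n : nat} (i : 'I_n) : (1 < n)%N -> i != ordS i.
Proof.
move=> n2; apply/eqP => /(congr1 val) /=; have [iN|iN] := eqVneq i.+1 n.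
  by rewrite iN modnn => i0; move: n2; rewrite -iN i0.
by rewrite modn_small => [|]; [lia|rewrite ltn_neqAle iN ltn_ord].
Qed.

(** * From short chords to short parameter gaps *)

Section GapBound.
Context {R : realType} {d : nat} (g : R -> 'rV[R]_d).
Context (k : R) (k0 : 0 < k).
Context (kb : forall s t, k * circle_dist 1 s t <= enorm (g s - g t)).
Context {n : nat} (n2 : (1 < n)%N) (b : 'I_n -> R) (sb : subdivision 1 b).

(** The bilipschitz bound controls the shorter of the arcs [gap] and [1 - gap]. The second is
    excluded: the other [n - 1] gaps add up to at least [c / 2], so its chord would be longer than
    [C / n]. *)
Lemma gap_upper_bound (c C : R) : 0 < c ->
  (forall i, c / n%:R <= gap 1 b i) ->
  (forall i, enorm (g (b (ordS i)) - g (b i)) <= C / n%:R) ->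
  C / n%:R < k * (c / 2) ->
  forall i, gap 1 b i <= C / k / n%:R.
Proof.
move=> c0 lb ub Cn i.
have N0 : 0 < n%:R :> R by rewrite ltr0n ltnW.
have g0 := gap_gt0 1 b sb i.
have rest : gap 1 b i <= 1 - c / 2.
  rewrite -[X in X - _](sum_gap 1 b (ltnW n2)) (bigD1 i)//= -addrA lerDl subr_ge0.
  apply: le_trans (_ : \sum_(j < n | j != i) c / n%:R <= _); last exact: ler_sum.
  rewrite sumr_const cardC1 card_ord -[leRHS]mulr_natr.
  have nn : n%:R <= 2 * (n.-1)%:R :> R by rewrite -natrM ler_nat; lia.
  have -> : c / 2 = c / n%:R * (n%:R / 2) by field; rewrite gt_eqF.
  by rewrite ler_pM2l ?divr_gt0//; lra.
have [m mE] := next_lift_congr b i.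
have fE : frac (b (ordS i) - b i) = gap 1 b i.
  by apply: (@fracE _ _ m); [lra|rewrite mE; ring].
have := le_trans (kb (b (ordS i)) (b i)) (ub i).
rewrite circle_dist1E fE; case: (leP (gap 1 b i) (1 - gap 1 b i)) => _ h.
  by rewrite mulrAC ler_pdivlMr// mulrC.
have : k * (c / 2) <= k * (1 - gap 1 b i) by rewrite ler_pM2l//; lra.
lra.
Qed.

End GapBound.

(** * Estimates near the diagonal *)

(** The difference of inverse squares is the defect [D ^+ 2 - X ^+ 2] over
    [X ^+ 2 * D ^+ 2 <= W ^+ 4]. *)
Lemma invsqB_ge {R : realType} (X D W p : R) : 0 < X -> X <= D -> D <= W ->
  p <= D ^+ 2 - X ^+ 2 -> p / W ^+ 4 <= X ^- 2 - D ^- 2.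
Proof.
move=> X0 XD DW pDX; have D0 : 0 < D by lra. have W0 : 0 < W by lra.
have sqmono (y z : R) : 0 < y -> y <= z -> y ^+ 2 <= z ^+ 2.
  by move=> y0 yz; rewrite ler_pXn2r ?nnegrE//; lra.
have -> : X ^- 2 - D ^- 2 = (D ^+ 2 - X ^+ 2) / (X ^+ 2 * D ^+ 2).
  by field; rewrite !gt_eqF.
apply: (@le_trans _ _ ((D ^+ 2 - X ^+ 2) / W ^+ 4)).
  by rewrite ler_wpM2r// invr_ge0 exprn_ge0// ltW.
rewrite ler_wpM2l ?subr_ge0 ?sqmono// lef_pV2 ?posrE ?mulr_gt0 ?exprn_gt0//.
rewrite (_ : W ^+ 4 = W ^+ 2 * W ^+ 2); last by rewrite -exprD.
by apply: ler_pM; rewrite ?sqr_ge0 ?sqmono//; lra.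
Qed.

Section Estimates.
Context {R : realType} {d : nat} (g : R -> 'rV[R]_d).
Context (gp : periodic g 1).
Context (gL : forall s t, enorm (g t - g s) <= `|t - s|).
Context (Efin : (moebius_energy g < +oo)%E).
Context (k : R) (k01 : 0 < k <= 1).
Context (kb : forall s t, k * circle_dist 1 s t <= enorm (g s - g t)).
Context {n : nat} (n2 : (1 < n)%N) (b : 'I_n -> R) (sb : subdivision 1 b).
Context (L : R) (a : 'I_n -> R) (sa : subdivision L a).
Context (edge : forall i, enorm (g (b (ordS i)) - g (b i)) = gap L a i).
Context (c C : R) (c0 : 0 < c).
Context (edge_lb : forall i, c / n%:R <= gap L a i).
Context (gap_ub : forall i, gap 1 b i <= C / n%:R).

Notation chord i j := (enorm (g (b i) - g (b j))).
Notation mass := (cell_mass g b).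
Notation h := (C / n%:R).
Notation M := (1 + 2 * C / c).
Notation v i j := (frac (b j - b i)).

Let n0 : (0 < n)%N := ltnW n2.
Let N0 : 0 < n%:R :> R.
Proof. by rewrite ltr0n. Qed.

Let gap_lb i : c / n%:R <= gap 1 b i.
Proof. exact: le_trans (edge_lb i) (edge_le_gap _ gp gL _ sb _ _ edge i). Qed.

Let C0 : 0 < C.
Proof.
have := le_trans (gap_lb (Ordinal n0)) (gap_ub (Ordinal n0)).
by rewrite ler_pM2r ?invr_gt0//; exact: lt_le_trans.
Qed.

Let h0 : 0 < h.
Proof. by rewrite divr_gt0. Qed.

Lemma circle_dist_frac i j : v i j <= 1 / 2 -> circle_dist 1 (b j) (b i) = v i j.
Proof. by rewrite circle_dist1E => vi; rewrite min_l//; lra. Qed.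

Lemma frac_lb i j : i != j -> c / n%:R <= v i j.
Proof. by move=> ij; apply: le_trans (gap_lb i) (gap_le_frac _ sb _ _ ij). Qed.

(* The defect [v^2 - chord^2] of an arc grows with the arc, so at (b_i, b_j)
   it is controlled by its values on the cell just outside. *)
Lemma near_cell_mass i j : i != j -> v i j + 2 * h <= 1 / 2 ->
  ((v i j) ^+ 2 - chord i j ^+ 2) / (M * v i j) ^+ 4 *
    (gap 1 b (ord_pred i) * gap 1 b j) <= mass (ord_pred i, j).
Proof.
move=> ij vh.
rewrite -lee_fin cell_massE//; apply: (moebius_mass_lb g gL); [exact: gap_itv..|].
move=> [s t] Az.
have [/= /arc_lift[m [x' [x'0 x'g sE]]] /arc_lift[l [y [y0 yg tE]]]] := Az.
have [k1 bE] := next_lift_congr b (ord_pred i).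
have [k2 vE] := frac_lift (b j - b i).
rewrite ord_predK in bE.
(* Up to integers [s = b i - x] and [t = b j + y]: the arc from [s] to [t] prolongs the one from
   [b i] to [b j] at both ends. *)
pose x := gap 1 b (ord_pred i) - x'.
have x0 : 0 < x by rewrite subr_gt0.
have xh : x <= h by have := gap_ub (ord_pred i); rewrite /x; lra.
have yh : y <= h by have := gap_ub j; lra.
have v0 := frac_ge0 (b j - b i).
have vc : c / n%:R <= v i j by exact: frac_lb.
have cn0 : 0 < c / n%:R by rewrite divr_gt0.
have {}sE : s = b i - x + (m - k1)%:~R by rewrite sE bE /x intrB; ring.
have chv : chord i j <= v i j.
  rewrite -circle_dist_frac; last by lra.
  by rewrite circle_distC chord_le_circle_dist.
have k0 : 0 < k by case/andP: k01.
have vp : 0 < v i j by lra.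
have ch0 : 0 < chord i j.
  apply: lt_le_trans (kb _ _); rewrite circle_distC circle_dist_frac; last by lra.
  by rewrite mulr_gt0.
have dE : circle_dist 1 s t = v i j + x + y.
  rewrite circle_distC circle_dist1E (@fracE _ (t - s) (l - m + k1 - k2) (v i j + x + y)).
  - by rewrite min_l//; lra.
  - by lra.
  - by rewrite tE sE vE !(intrD, intrB); ring.
apply: (@le_trans _ _ ((chord i j + x + y) ^- 2 - (v i j + x + y) ^- 2)%:E).
  rewrite lee_fin; apply: invsqB_ge; [lra|lra| |].
    (* As [v i j >= c / n], each prolongation, at most [C / n], is at most [C / c * v i j]; this is
       the origin of [M]. *)
    have -> : M * v i j = v i j + 2 * (C / c * v i j) by ring.
    have : h <= C / c * v i j; last by lra.
    have -> : h = C / c * (c / n%:R) by field; rewrite !gt_eqF.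
    by rewrite ler_pM2l// divr_gt0.
  (* Monotonicity of the defect: prolonging by [z = x + y] adds [2 z (v - chord) >= 0]. *)
  by nra.
apply: moebius_density_lb => //; [exact: arc_square Az|lra|lra| |by rewrite dE].
rewrite sE tE !periodicz//.
have := enorm_triangle (g (b i - x)) (g (b i)) (g (b j + y)).
have := enorm_triangle (g (b i)) (g (b j)) (g (b j + y)).
have := gL (b i) (b i - x); have := gL (b j + y) (b j).
rewrite opprD addrA subrr add0r normrN (ger0_norm y0).
rewrite addrAC subrr add0r normrN (gtr0_norm x0).
lra.
Qed.

Let M1 : 1 <= M.
Proof. by rewrite lerDl -mulrA mulr_ge0// ltW// divr_gt0. Qed.

(* The polygon lengths converge to 1 because the energy controls the defect
   of each edge. *)
Lemma length_defect : 3 * h <= 1 / 2 ->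
  1 - L <= M ^+ 4 * C ^+ 3 / c ^+ 2 / n%:R * fine (moebius_energy g).
Proof.
move: (c0) (h0) (C0) (M1) => cp hp Cp Mp hs.
pose A := M ^+ 4 * C ^+ 3 / c ^+ 2 / n%:R.
have A0 : 0 <= A.
  by rewrite /A !mulr_ge0 ?invr_ge0 ?exprn_ge0// ltW//; lra.
have edge_defect i : gap 1 b i - gap L a i <= A * mass (ord_pred i, ordS i).
  have ii : i != ordS i by exact: ordS_neq.
  have [m mE] := next_lift_congr b i.
  have gh := gap_ub i.
  have vE : v i (ordS i) = gap 1 b i.
    by apply: (@fracE _ _ m); [have := gap_gt0 _ _ sb i; lra|rewrite mE; ring].
  have vh : v i (ordS i) + 2 * h <= 1 / 2 by rewrite vE; lra.
  have := near_cell_mass i (ordS i) ii vh.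
  rewrite vE enormB edge.
  set q := gap 1 b i; set l := gap L a i; set w := mass _.
  have q0 : 0 < q by exact: gap_gt0.
  have cn0 : 0 < c / n%:R by rewrite divr_gt0.
  have lq : l <= q by exact: (edge_le_gap _ gp gL _ sb _ _ edge i).
  have l0 : 0 < l by apply: lt_le_trans (edge_lb i).
  have ql0 : 0 <= q - l by rewrite subr_ge0.
  have Mq0 : 0 < (M * q) ^+ 4 by rewrite exprn_gt0// mulr_gt0//; lra.
  set g1 := gap 1 b (ord_pred i); set g2 := gap 1 b (ordS i) => H.
  have g1c : c / n%:R <= g1 by exact: gap_lb.
  have g2c : c / n%:R <= g2 by exact: gap_lb.
  have w0 : 0 <= w by exact: cell_mass_ge0.
  (* The defect factors as [(q - l) (q + l) >= (q - l) q], and both sides of the cell are at least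
     [c / n]. *)
  have step : (q - l) * q / (M * q) ^+ 4 * (c / n%:R) ^+ 2 <= w.
    apply: le_trans H.
    apply: ler_pM; [|exact: sqr_ge0| |].
    - by apply: divr_ge0; [rewrite mulr_ge0 // ltW|exact: ltW].
    - by rewrite ler_wpM2r// ?invr_ge0 ?(ltW Mq0)//; nra.
    - by rewrite expr2; apply: ler_pM => //; exact: ltW.
  have -> : q - l = M ^+ 4 * q ^+ 3 / (c / n%:R) ^+ 2 *
      ((q - l) * q / (M * q) ^+ 4 * (c / n%:R) ^+ 2).
    by field; rewrite !gt_eqF//; lra.
  apply: ler_pM => //.
  - by rewrite !mulr_ge0 ?invr_ge0 ?exprn_ge0// ltW//; lra.
  - apply: mulr_ge0; last exact: sqr_ge0.
    by apply: divr_ge0; [rewrite mulr_ge0 // ltW|exact: ltW].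
  have -> : A = M ^+ 4 * h ^+ 3 / (c / n%:R) ^+ 2.
    by rewrite /A; field; rewrite !gt_eqF.
  rewrite ler_wpM2r ?invr_ge0 ?sqr_ge0// ler_wpM2l ?exprn_ge0//; first by lra.
  by rewrite ler_pXn2r ?nnegrE ?(ltW q0) ?(ltW h0).
have -> : 1 - L = \sum_i (gap 1 b i - gap L a i) by rewrite sumrB !sum_gap.
apply: (@le_trans _ _ (\sum_i A * mass (ord_pred i, ordS i))); first exact: ler_sum.
rewrite -/A -mulr_sumr ler_wpM2l//.
have -> : fine (moebius_energy g) = \sum_i \sum_j mass (i, j).
  rewrite -(sum_cell_mass g gp gL Efin n0 b sb) /= pair_big/=.
  by apply: eq_bigr => -[].
(* Every row of cells contributes one of the masses, so their sum is at most the total energy. *)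
rewrite [leRHS](reindex_inj (@ord_pred_inj n)) ler_sum// => i _.
rewrite (bigD1 (ordS i))//= lerDl sumr_ge0// => j _; exact: cell_mass_ge0.
Qed.

End Estimates.

(** * Comparison of the discrete energy with the energies of the cells *)

(** For a pair of vertices, [x] is the chord, [y] and [D] are the distances on polygon and circle,
    [e = 1 - L], and [r] bounds the variation over the cell. All quantities stay above [m], so
    [invsq_le] applies to each inverse square. *)
Lemma kernel_perturbation {R : realType} (m x y D e r : R) :
  0 < m -> 2 * m <= x -> x <= y -> y <= D -> D <= y + e -> 0 <= r -> r <= m ->
  x ^- 2 - y ^- 2 - 2 / m ^+ 3 * (2 * r + e) <= (x + r) ^- 2 - (D - r) ^- 2 /\
  (x - r) ^- 2 - (D + r) ^- 2 <= x ^- 2 - y ^- 2 + 2 / m ^+ 3 * (2 * r + e).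
Proof.
move=> m0 mx xy yD De r0 rm.
have e0 : 0 <= 2 / m ^+ 3 * e.
  by rewrite mulr_ge0 ?divr_ge0 ?exprn_ge0 ?(ltW m0)//; lra.
have i1 : x ^- 2 <= (x + r) ^- 2 + 2 / m ^+ 3 * r by apply: invsq_le; lra.
have i2 : (D - r) ^- 2 <= y ^- 2 + 2 / m ^+ 3 * r by apply: invsq_le; lra.
have i3 : (x - r) ^- 2 <= x ^- 2 + 2 / m ^+ 3 * r by apply: invsq_le; lra.
have i4 : y ^- 2 <= (D + r) ^- 2 + 2 / m ^+ 3 * (r + e) by apply: invsq_le; lra.
by split; lra.
Qed.

Section Comparison.
Context {R : realType} {d : nat} (g : R -> 'rV[R]_d).
Context (gp : periodic g 1).
Context (gL : forall s t, enorm (g t - g s) <= `|t - s|).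
Context (Efin : (moebius_energy g < +oo)%E).
Context (k : R) (k01 : 0 < k <= 1).
Context (kb : forall s t, k * circle_dist 1 s t <= enorm (g s - g t)).
Context {n : nat} (n2 : (1 < n)%N) (b : 'I_n -> R) (sb : subdivision 1 b).
Context (L : R) (a : 'I_n -> R) (sa : subdivision L a).
Context (edge : forall i, enorm (g (b (ordS i)) - g (b i)) = gap L a i).
Context (c C : R) (c0 : 0 < c).
Context (edge_lb : forall i, c / n%:R <= gap L a i).
Context (gap_ub : forall i, gap 1 b i <= C / n%:R).

Notation chord i j := (enorm (g (b i) - g (b j))).
Notation mass := (cell_mass g b).
Notation h := (C / n%:R).
Notation M := (1 + 2 * C / c).
Notation v i j := (frac (b j - b i)).
Notation mu2 := (@lebesgue_measure R \x @lebesgue_measure R)%E.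

Let n0 : (0 < n)%N := ltnW n2.
Let N0 : 0 < n%:R :> R.
Proof. by rewrite ltr0n. Qed.

Let gap_lb i : c / n%:R <= gap 1 b i.
Proof. exact: le_trans (edge_lb i) (edge_le_gap _ gp gL _ sb _ _ edge i). Qed.

Let C0 : 0 < C.
Proof.
have := le_trans (gap_lb (Ordinal n0)) (gap_ub (Ordinal n0)).
by rewrite ler_pM2r ?invr_gt0//; exact: lt_le_trans.
Qed.

Let h0 : 0 < h.
Proof. by rewrite divr_gt0. Qed.

Let cn0 : 0 < c / n%:R.
Proof. by rewrite divr_gt0. Qed.

Let gap0 i : 0 < gap 1 b i.
Proof. exact: lt_le_trans (gap_lb i). Qed.

Let edge0 i : 0 < gap L a i.
Proof. exact: lt_le_trans (edge_lb i). Qed.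

Let edge_gap i : gap L a i <= gap 1 b i.
Proof. exact: (edge_le_gap _ gp gL _ sb _ _ edge i). Qed.

Let cmp i j := polygon_dist_cmp _ gp gL n0 _ sb _ _ sa edge i j.

(** The chord is common to curve and polygon, while the distance is the intrinsic one of the
    polygon. *)
Definition kernel_term (i j : 'I_n) : R :=
  chord i j ^- 2 - circle_dist L (a j) (a i) ^- 2.

Definition energy_term (i j : 'I_n) : R :=
  kernel_term i j * gap L a i * gap L a j.

Lemma chord_gt0 i j : i != j -> 0 < chord i j.
Proof.
move=> ij; have [y0 _ yd _] := cmp _ _ ij; rewrite enormB.
by apply: lt_le_trans (kb _ _); apply: mulr_gt0; [case/andP: k01|exact: lt_le_trans yd].
Qed.

Lemma kernel_term_ge0 i j : i != j -> 0 <= kernel_term i j.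
Proof.
move=> ij; have [y0 cy _ _] := cmp _ _ ij; rewrite enormB in cy.
have ch0 := chord_gt0 _ _ ij.
by rewrite subr_ge0 lef_pV2 ?posrE ?exprn_gt0// ler_pXn2r ?nnegrE// ltW.
Qed.

Lemma energy_term_ge0 i j : i != j -> 0 <= energy_term i j.
Proof. by move=> ij; rewrite !mulr_ge0 ?kernel_term_ge0// ltW. Qed.

Lemma energy_termC i j : energy_term i j = energy_term j i.
Proof. by rewrite /energy_term /kernel_term enormB circle_distC mulrAC. Qed.

(** The polygon distance is at most [v] and the chord at least [k v], so the kernel is at most
    [(v ^+ 2 - chord ^+ 2) / (k ^+ 2 v ^+ 4)], which [near_cell_mass] controls. The factor
    [M ^+ 4 / k ^+ 2] compares denominators; [C / c] compares the edge at [i] with the preceding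
    gap. *)
Lemma near_term i j : i != j -> v i j + 2 * h <= 1 / 2 ->
  energy_term i j <= C * M ^+ 4 / (c * k ^+ 2) * mass (ord_pred i, j).
Proof.
move: (c0) (h0) (C0) (k01) => cp hp Cp kp ij vh.
have := near_cell_mass g gp gL Efin k k01 kb n2 b sb L a edge c C c0 edge_lb gap_ub i j ij vh.
have [y0 cy yv _] := cmp _ _ ij; rewrite enormB in cy.
rewrite circle_dist_frac in yv; last by lra.
have ch0 := chord_gt0 _ _ ij.
have kv : k * v i j <= chord i j.
  have := kb (b j) (b i); rewrite circle_dist_frac 1?enormB//.
  by lra.
have M1 : 1 <= M by rewrite lerDl -mulrA mulr_ge0// ltW// divr_gt0.
move: kv yv cy; rewrite /energy_term /kernel_term.
set V := v i j; set ch := chord i j; set y := circle_dist _ _ _ => kv yv cy H.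
have V0 : 0 < V by lra. have k0 : 0 < k by lra.
have q0 : 0 <= ch ^- 2 - y ^- 2 by exact: kernel_term_ge0.
have Mp : 0 < M by lra.
have sqmono (s t : R) : 0 < s -> s <= t -> s ^+ 2 <= t ^+ 2.
  by move=> s0 st; rewrite ler_pXn2r ?nnegrE//; lra.
have p0 : 0 <= V ^+ 2 - ch ^+ 2 by rewrite subr_ge0 sqmono//; lra.
have q_le : ch ^- 2 - y ^- 2 <= (V ^+ 2 - ch ^+ 2) / (k ^+ 2 * V ^+ 4).
  apply: (@le_trans _ _ (ch ^- 2 - V ^- 2)).
    by rewrite lerB// lef_pV2 ?posrE ?exprn_gt0// sqmono.
  have -> : ch ^- 2 - V ^- 2 = (V ^+ 2 - ch ^+ 2) / (ch ^+ 2 * V ^+ 2).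
    by field; rewrite !gt_eqF.
  rewrite ler_wpM2l// lef_pV2 ?posrE ?mulr_gt0 ?exprn_gt0//.
  rewrite (_ : k ^+ 2 * V ^+ 4 = (k * V) ^+ 2 * V ^+ 2); last by ring.
  by rewrite ler_wpM2r ?sqr_ge0// sqmono// mulr_gt0.
apply: (@le_trans _ _ ((V ^+ 2 - ch ^+ 2) / (k ^+ 2 * V ^+ 4) * h * gap 1 b j)).
  have e1 := edge_gap i; have e2 := edge_gap j; have e3 := gap_ub i.
  have e4 := edge0 i; have e5 := edge0 j.
  apply: ler_pM => //; [by rewrite mulr_ge0// ltW|exact: ltW|].
  by apply: ler_pM => //; [exact: ltW|lra].
apply: (@le_trans _ _ (C * M ^+ 4 / (c * k ^+ 2) *
  ((V ^+ 2 - ch ^+ 2) / (M * V) ^+ 4 * (gap 1 b (ord_pred i) * gap 1 b j)))); last first.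
  by rewrite ler_wpM2l// !mulr_ge0 ?invr_ge0 ?exprn_ge0 ?mulr_ge0 ?exprn_ge0//; try exact: ltW.
have -> : C * M ^+ 4 / (c * k ^+ 2) * ((V ^+ 2 - ch ^+ 2) / (M * V) ^+ 4 *
    (gap 1 b (ord_pred i) * gap 1 b j)) =
  (V ^+ 2 - ch ^+ 2) / (k ^+ 2 * V ^+ 4) * (C / c * gap 1 b (ord_pred i)) * gap 1 b j.
  by field; rewrite !gt_eqF//; lra.
rewrite ler_wpM2r ?(ltW (gap0 _))// ler_wpM2l//.
  by rewrite divr_ge0// mulr_ge0 ?exprn_ge0// ltW.
have -> : h = C / c * (c / n%:R) by field; rewrite !gt_eqF.
by rewrite ler_wpM2l// divr_ge0// ltW.
Qed.

Lemma cell_strip i j s t x y (p q : int) (e : R) :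
  circle_dist 1 (b i) (b j) <= e -> unit_square (s, t) ->
  s = b i + x + p%:~R -> t = b j + y + q%:~R -> `|x| <= h -> `|y| <= h ->
  strip (e + 2 * h) (s, t).
Proof.
move=> de Qst sE tE xh yh; split => //=.
have := circle_dist1_trans (b i) (b j) s t x y p q sE tE.
by rewrite ler_norml => /andP[_ h2]; lra.
Qed.

Lemma cell_subset_strip i j e : circle_dist 1 (b i) (b j) <= e ->
  cell b (i, j) `<=` strip (e + 2 * h).
Proof.
move=> de [s t] Az.
have [/= /arc_lift[p [x [x0 xg sE]]] /arc_lift[q [y [y0 yg tE]]]] := Az.
have gi := gap_ub i; have gj := gap_ub j.
by apply: (cell_strip i j s t x y p q) => //;
  [exact: arc_square Az|rewrite ger0_norm; lra|rewrite ger0_norm; lra].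
Qed.

Lemma pred_cell_subset_strip i j e : v i j <= e ->
  cell b (ord_pred i, j) `<=` strip (e + 2 * h).
Proof.
move=> de [s t] Az.
have [/= /arc_lift[p [x [x0 xg sE]]] /arc_lift[q [y [y0 yg tE]]]] := Az.
have gi := gap_ub (ord_pred i); have gj := gap_ub j.
have [r bE] := next_lift_congr b (ord_pred i); rewrite ord_predK in bE.
apply: (cell_strip i j s t (x - gap 1 b (ord_pred i)) y (p - r) q) => //.
- rewrite circle_distC circle_dist1E; apply: le_trans de.
  by rewrite ge_min lexx.
- exact: arc_square Az.
- by rewrite sE bE intrB; ring.
- by rewrite ler0_norm; lra.
- by rewrite ger0_norm; lra.
Qed.

(** The first error is the variation of the kernel over the cell, by [kernel_perturbation] with
    [r = 2 h] and [e = 1 - L]. The second is the area of the cell minus the product of the edge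
    lengths, weighted by the bound [m ^- 2] of the kernel. Here [m] is half of [k * delta], a lower
    bound of the chord. *)
Lemma far_term i j delta : i != j -> 0 < delta ->
  2 * h <= k * delta / 2 -> delta < circle_dist 1 (b i) (b j) ->
  `|mass (i, j) - energy_term i j| <=
    2 / (k * delta / 2) ^+ 3 * (4 * h + (1 - L)) * (gap 1 b i * gap 1 b j) +
    (k * delta / 2) ^- 2 * (gap 1 b i * (gap 1 b j - gap L a j) +
                            gap 1 b j * (gap 1 b i - gap L a i)).
Proof.
move: (c0) (h0) (C0) (k01) => cp hp Cp kp ij delta0 hm far; set m := k * delta / 2 in hm *.
have k0 : 0 < k by lra.
have m0 : 0 < m by rewrite divr_gt0// mulr_gt0.
have L1 : L <= 1 := polygon_length_le1 _ gp gL n0 _ sb _ _ edge.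
have [y0 cy yd dy] := cmp _ _ ij; rewrite enormB in cy.
rewrite (circle_distC 1) in yd dy.
have ch0 := chord_gt0 _ _ ij.
have kd : k * delta <= delta by rewrite ler_piMl//; lra.
have md : 2 * m <= delta by rewrite /m; lra.
have chm : 2 * m <= chord i j.
  apply: le_trans (kb _ _); rewrite /m mulrC divfK// ler_pM2l//; lra.
set q := kernel_term i j; set th := 2 / m ^+ 3 * (4 * h + (1 - L)).
have c30 : 0 <= 2 / m ^+ 3 by rewrite divr_ge0// exprn_ge0// ltW.
have q0 : 0 <= q by exact: kernel_term_ge0.
set y := circle_dist L (a j) (a i) in y0 cy yd dy.
set D := circle_dist 1 (b i) (b j) in far yd dy.
set ch := chord i j in ch0 chm cy.
have qm : q <= m ^- 2.
  rewrite /q /kernel_term -/ch -/y.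
  have : ch ^- 2 <= m ^- 2.
    by rewrite lef_pV2 ?posrE ?exprn_gt0// ler_pXn2r ?nnegrE//; lra.
  have : 0 <= y ^- 2 by rewrite invr_ge0 sqr_ge0.
  lra.
have points s t : cell b (i, j) (s, t) -> [/\ unit_square (s, t),
    `|circle_dist 1 s t - D| <= 2 * h & `|enorm (g s - g t) - ch| <= 2 * h].
  move=> Az.
  have [/= /arc_lift[p [x [x0 xg sE]]] /arc_lift[r [w [w0 wg tE]]]] := Az.
  have gi := gap_ub i; have gj := gap_ub j.
  split; first exact: arc_square Az.
    apply: le_trans (circle_dist1_trans _ _ _ _ _ _ _ _ sE tE) _.
    by rewrite !ger0_norm//; lra.
  rewrite sE tE !periodicz// ler_norml.
  have t1 := enorm_triangle (g (b i + x)) (g (b i)) (g (b j + w)).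
  have t2 := enorm_triangle (g (b i)) (g (b j)) (g (b j + w)).
  have t3 := enorm_triangle (g (b i)) (g (b i + x)) (g (b j)).
  have t4 := enorm_triangle (g (b i + x)) (g (b j + w)) (g (b j)).
  have l1 := gL (b i) (b i + x); have l2 := gL (b j) (b j + w).
  rewrite addrAC subrr add0r (ger0_norm x0) in l1.
  rewrite addrAC subrr add0r (ger0_norm w0) in l2.
  rewrite (enormB (g (b i)) (g (b i + x))) in t3.
  rewrite (enormB (g (b j)) (g (b j + w))) in t2.
  by rewrite /ch; apply/andP; split; lra.
have [q_lb q_ub] : q - th <= (ch + 2 * h) ^- 2 - (D - 2 * h) ^- 2 /\
    (ch - 2 * h) ^- 2 - (D + 2 * h) ^- 2 <= q + th.
  rewrite /q /th (_ : 4 * h + (1 - L) = 2 * (2 * h) + (1 - L)); last by ring.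
  by apply: kernel_perturbation; rewrite // mulr_ge0// ltW.
have ch2 : 0 < ch + 2 * h by rewrite addr_gt0// mulr_gt0.
have hD : 2 * h < D by lra.
have hch : 2 * h < ch by lra.
have mass_lb : (q - th) * (gap 1 b i * gap 1 b j) <= mass (i, j).
  rewrite -lee_fin cell_massE//.
  apply: (moebius_mass_lb g gL); [exact: gap_itv..|] => -[s t] /points[Qst].
  rewrite !ler_norml => /andP[d1 d2] /andP[c1 c2].
  apply: (@le_trans _ _ ((ch + 2 * h) ^- 2 - (D - 2 * h) ^- 2)%:E); last first.
    have chD : enorm (g s - g t) <= ch + 2 * h by rewrite -lerBlDl.
    have dD : D - 2 * h <= circle_dist 1 s t by rewrite -lerBrDl.
    by apply: moebius_density_lb => //; rewrite subr_gt0.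
  by rewrite lee_fin.
have mass_ub : mass (i, j) <= (q + th) * (gap 1 b i * gap 1 b j).
  rewrite -lee_fin cell_massE//.
  apply: (moebius_mass_ub g gL); [exact: gap_itv..|] => -[s t] /points[Qst].
  rewrite !ler_norml => /andP[d1 d2] /andP[c1 c2].
  apply: (@le_trans _ _ ((ch - 2 * h) ^- 2 - (D + 2 * h) ^- 2)%:E).
    have dD : circle_dist 1 s t <= D + 2 * h by rewrite -lerBlDl.
    by apply: moebius_density_ub => //; [rewrite subr_gt0|rewrite -lerBrDl].
  by rewrite lee_fin.
have eg i' := edge_gap i'; have e0 i' := edge0 i'.
have hp1 : 0 <= q * (gap 1 b i * gap 1 b j - gap L a i * gap L a j).
  rewrite mulr_ge0// subr_ge0; apply: ler_pM => //; exact: ltW.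
have hp2 : q * (gap 1 b i * gap 1 b j - gap L a i * gap L a j) <=
    m ^- 2 * (gap 1 b i * (gap 1 b j - gap L a j) + gap 1 b j * (gap 1 b i - gap L a i)).
  have ei := eg i; have ej := eg j; have li := e0 i; have lj := e0 j.
  apply: ler_pM => //.
    by rewrite subr_ge0; apply: ler_pM => //; exact: ltW.
  by nra.
have -> : energy_term i j = q * (gap 1 b i * gap 1 b j) -
    q * (gap 1 b i * gap 1 b j - gap L a i * gap L a j).
  by rewrite /energy_term -/q; ring.
rewrite -/th ler_norml; apply/andP; split; lra.
Qed.

End Comparison.

(** * Summation of the near and far errors *)

Section Total.
Context {R : realType} {d : nat} (g : R -> 'rV[R]_d).
Context (gp : periodic g 1).
Context (gL : forall s t, enorm (g t - g s) <= `|t - s|).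
Context (Efin : (moebius_energy g < +oo)%E).
Context (k : R) (k01 : 0 < k <= 1).
Context (kb : forall s t, k * circle_dist 1 s t <= enorm (g s - g t)).
Context {n : nat} (n2 : (1 < n)%N) (b : 'I_n -> R) (sb : subdivision 1 b).
Context (L : R) (a : 'I_n -> R) (sa : subdivision L a).
Context (edge : forall i, enorm (g (b (ordS i)) - g (b i)) = gap L a i).
Context (c C : R) (c0 : 0 < c) (C0 : 0 < C).
Context (edge_lb : forall i, c / n%:R <= gap L a i).
Context (gap_ub : forall i, gap 1 b i <= C / n%:R).

Notation mass := (cell_mass g b).
Notation h := (C / n%:R).
Notation M := (1 + 2 * C / c).
Notation v i j := (frac (b j - b i)).
Notation mu2 := (@lebesgue_measure R \x @lebesgue_measure R)%E.
Notation B := (C * M ^+ 4 / (c * k ^+ 2)).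
Notation term := (energy_term g b L a).

(** Pairs are near or far according to [delta]. Far errors sum to the first two terms, since the
    gaps sum to 1 and the edge defects to [1 - L]. In [2 * B + 1], the 1 counts the masses of near
    cells and each [B] the near discrete terms of one orientation. *)
Lemma total_error (delta S : R) : 0 < delta -> 2 * h <= k * delta / 2 ->
  delta + 2 * h <= 1 / 2 ->
  (\int[mu2]_(z in strip (delta + 2 * h)) moebius_density g z <= S%:E)%E ->
  `|\sum_i \sum_(j | i != j) term i j - fine (moebius_energy g)| <=
  2 / (k * delta / 2) ^+ 3 * (4 * h + (1 - L)) +
  2 * (k * delta / 2) ^- 2 * (1 - L) + (2 * B + 1) * S.
Proof.
move=> delta0 hm hd hS; set m := k * delta / 2 in hm *.
move: (c0) (C0) (k01) => cp Cp kp.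
have k0 : 0 < k by lra.
have n0 : (0 < n)%N by exact: ltnW.
have L1 : L <= 1 := polygon_length_le1 _ gp gL n0 _ sb _ _ edge.
have h0 : 0 < h by rewrite divr_gt0// ltr0n.
have m0 : 0 < m by rewrite divr_gt0// mulr_gt0.
have M0 : 0 < M by rewrite addr_gt0// divr_gt0// mulr_gt0.
have B0 : 0 <= B by rewrite divr_ge0 ?mulr_ge0 ?exprn_ge0// ltW.
pose th := 2 / m ^+ 3 * (4 * h + (1 - L)).
have th0 : 0 <= th.
  by rewrite mulr_ge0 ?divr_ge0 ?exprn_ge0 ?(ltW m0)//; lra.
pose far (ij : 'I_n * 'I_n) :=
  th * (gap 1 b ij.1 * gap 1 b ij.2) +
  m ^- 2 * (gap 1 b ij.1 * (gap 1 b ij.2 - gap L a ij.2) +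
            gap 1 b ij.2 * (gap 1 b ij.1 - gap L a ij.1)).
pose near (ij : 'I_n * 'I_n) := circle_dist 1 (b ij.1) (b ij.2) <= delta.
(* [near_term] needs the arc running forward from the first point to be short; a near pair of
   distinct indices has this property in one of its two orders. *)
pose fw (i j : 'I_n) := (i != j) && (v i j <= delta).
pose err (ij : 'I_n * 'I_n) := (if ij.1 != ij.2 then term ij.1 ij.2 else 0) - mass ij.
have eg i := edge_le_gap _ gp gL _ sb _ _ edge i.
have g0 i := ltW (gap_gt0 _ _ sb i).
have w0 ij : 0 <= mass ij := cell_mass_ge0 g b ij.
have far0 ij : 0 <= far ij.
  apply: addr_ge0; first by apply: mulr_ge0 => //; exact: mulr_ge0.
  apply: mulr_ge0; first by rewrite invr_ge0 sqr_ge0.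
  by apply: addr_ge0; apply: mulr_ge0 => //; rewrite subr_ge0.
(* All bounds are nonnegative, so they can be added for every pair and then summed separately over
   all indices. *)
have err_le ij : `|err ij| <= far ij + (if near ij then mass ij else 0) +
    ((if fw ij.1 ij.2 then B * mass (ord_pred ij.1, ij.2) else 0) +
     (if fw ij.2 ij.1 then B * mass (ord_pred ij.2, ij.1) else 0)).
  have near_err (f w A A' t : R) : 0 <= f -> 0 <= w -> 0 <= t -> t <= A + A' ->
      `|t - w| <= f + w + (A + A').
    by move=> f0 w0' t0 tA; rewrite ler_norml; apply/andP; split; lra.
  case: ij => i j; rewrite /err /=.
  have fw0 i' j' : 0 <= (if fw i' j' then B * mass (ord_pred i', j') else 0).
    by case: ifP => _ //; rewrite mulr_ge0.
  have near_fw i' j' : fw i' j' -> term i' j' <= B * mass (ord_pred i', j').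
    move=> /andP[ij vd].
    apply: (near_term g gp gL Efin k k01 kb n2 b sb L a sa edge c C c0 edge_lb gap_ub i' j' ij).
    by lra.
  have f1 := fw0 i j; have f2 := fw0 j i; have f0 := far0 (i, j).
  have wij := w0 (i, j).
  have [ij|nij] /= := eqVneq i j.
    have nr : near (i, j).
      rewrite /near ij/= circle_dist1E subrr (@frac_id _ 0) ?lexx ?ltr01//.
      by rewrite ge_min (ltW delta0).
    rewrite sub0r normrN (ger0_norm (w0 _)) nr addrAC lerDr.
    by apply: addr_ge0 => //; exact: addr_ge0.
  case: ifPn => [nr|]; last first.
    rewrite /near/= -ltNge => fr.
    have := far_term g gp gL Efin k k01 kb n2 b sb L a sa edge c C c0 edge_lb
      gap_ub i j delta nij delta0 hm fr.
    rewrite distrC -/m -/th => /le_trans; apply.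
    by rewrite addr0 lerDl addr_ge0.
  have t0 := energy_term_ge0 g gp gL k k01 kb n2 b sb L a sa edge c c0 edge_lb i j nij.
  suff tfw : term i j <= (if fw i j then B * mass (ord_pred i, j) else 0) +
                         (if fw j i then B * mass (ord_pred j, i) else 0).
    by apply: near_err.
  move: nr; rewrite /near/= circle_dist1E ge_min => /orP[vd|vd].
    have fji : fw j i by rewrite /fw eq_sym nij.
    rewrite fji energy_termC; apply: le_trans (near_fw _ _ fji) _.
    by rewrite lerDr.
  have fij : fw i j.
    rewrite /fw nij/= -(opprB (b i)) frac_opp// gt_eqF//.
    have := frac_lt1 (b i - b j); lra.
  by rewrite fij; apply: le_trans (near_fw _ _ fij) _; rewrite lerDl.
have -> : \sum_i \sum_(j | i != j) term i j - fine (moebius_energy g) = \sum_ij err ij.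
  rewrite -(sum_cell_mass g gp gL Efin n0 b sb)/= sumrB; congr (_ - _).
  rewrite (eq_bigr (fun i => \sum_j (if i != j then term i j else 0))); last first.
    by move=> i _; rewrite big_mkcond.
  by rewrite pair_big/=.
apply: (le_trans (ler_norm_sum _ _ _)).
apply: (le_trans (ler_sum _ (fun ij _ => err_le ij))).
rewrite !big_split/=.
have sum_gg (F G : 'I_n -> R) : \sum_(ij : 'I_n * 'I_n) F ij.1 * G ij.2 = (\sum_i F i) * (\sum_j G j).
  by rewrite big_distrlr/= pair_big.
have sum_far : \sum_ij th * (gap 1 b ij.1 * gap 1 b ij.2) = th.
  by rewrite -mulr_sumr sum_gg !sum_gap// !mulr1.
have sum_def : \sum_i (gap 1 b i - gap L a i) = 1 - L by rewrite sumrB !sum_gap.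
have sum_far2 : \sum_(ij : 'I_n * 'I_n) m ^- 2 * (gap 1 b ij.1 * (gap 1 b ij.2 - gap L a ij.2) +
            gap 1 b ij.2 * (gap 1 b ij.1 - gap L a ij.1)) = 2 * m ^- 2 * (1 - L).
  rewrite -mulr_sumr big_split/= (sum_gg (gap 1 b) (fun j => gap 1 b j - gap L a j)).
  rewrite (eq_bigr (fun ij : 'I_n * 'I_n => (gap 1 b ij.1 - gap L a ij.1) * gap 1 b ij.2)); last first.
    by move=> ij _; rewrite mulrC.
  rewrite (sum_gg (fun j => gap 1 b j - gap L a j) (gap 1 b)) sum_def sum_gap//.
  by ring.
rewrite sum_far sum_far2.
have mS := measurable_strip (R := R) (delta + 2 * h).
have sum_near : \sum_ij (if near ij then mass ij else 0) <= S.
  rewrite -big_mkcond -lee_fin; apply: le_trans hS.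
  apply: (sum_cell_mass_le g gp gL Efin b sb) => // -[i j] ?.
  exact: (cell_subset_strip b C gap_ub).
have sum_fw : \sum_(ij : 'I_n * 'I_n) (if fw ij.1 ij.2 then B * mass (ord_pred ij.1, ij.2) else 0) <= B * S.
  rewrite -big_mkcond -mulr_sumr ler_wpM2l//.
  (* After this shift [ord_pred] disappears: the masses belong to distinct cells, all inside the
     strip. *)
  pose s (ij : 'I_n * 'I_n) := (ordS ij.1, ij.2).
  have s_inj : injective s.
    move=> [i j] [i' j'] e; have /= e2 := congr1 snd e.
    by have /ordS_inj /= -> := congr1 fst e; rewrite e2.
  rewrite (reindex_inj s_inj)/=.
  under eq_bigr do rewrite ordSK.
  rewrite -lee_fin; apply: le_trans hS.
  rewrite (eq_bigr (fun ij => mass ij)); last by case.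
  apply: (sum_cell_mass_le g gp gL Efin b sb) => // -[i j] /andP[_ vd].
  by rewrite -[i]ordSK; exact: (pred_cell_subset_strip b C gap_ub).
have sum_bw : \sum_(ij : 'I_n * 'I_n) (if fw ij.2 ij.1 then B * mass (ord_pred ij.2, ij.1) else 0) <= B * S.
  apply: le_trans sum_fw; rewrite le_eqVlt; apply/orP; left; apply/eqP.
  pose s (ij : 'I_n * 'I_n) := (ij.2, ij.1).
  have s_inj : injective s by move=> [i j] [i' j'] [-> ->].
  by rewrite (reindex_inj s_inj).
rewrite -/th; lra.
Qed.

End Total.

(** * Real form of the discrete energy and passage to the limit *)

Lemma discrete_moebius_energyE {R : realType} {d n : nat} (g : R -> 'rV[R]_d)
    (b : 'I_n -> R) (L : R) (p : R -> 'rV[R]_d) (a : 'I_n -> R) :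
  (forall i, p (a i) = g (b i)) ->
  (forall i, enorm (g (b (ordS i)) - g (b i)) = gap L a i) ->
  (forall i j, i != j -> 0 < enorm (g (b i) - g (b j))) ->
  (forall i j, i != j -> 0 < circle_dist L (a j) (a i)) ->
  discrete_moebius_energy L p a =
  (\sum_i \sum_(j | i != j) energy_term g b L a i j)%:E.
Proof.
move=> pg edge ch0 y0; rewrite /discrete_moebius_energy.
rewrite -sumEFin; apply: eq_bigr => i _; rewrite -sumEFin; apply: eq_bigr => j ij.
rewrite /edge_length /= !pg !edge !inver enormB.
rewrite (gt_eqF (exprn_gt0 _ (ch0 _ _ ij))) (gt_eqF (exprn_gt0 _ (y0 _ _ ij))).
by rewrite -EFinB -!EFinM.
Qed.

Lemma near_natdiv_lt {R : realType} (K e : R) : 0 < e ->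
  \forall n \near \oo, K / n%:R < e.
Proof.
move=> e0; near=> n.
have n0 : 0 < n%:R :> R by rewrite ltr0n; near: n; exact: nbhs_infty_gt.
rewrite ltr_pdivrMr// mulrC -ltr_pdivrMr//.
by near: n; exact: nbhs_infty_gtr.
Unshelve. all: by end_near.
Qed.

Theorem corollary4 (R : realType) (d : nat) (g : R -> 'rV[R]_d) (c cbar : R)
    (b : forall n : nat, 'I_n -> R)
    (p : forall n : nat, R -> 'rV[R]_d)
    (a : forall n : nat, 'I_n -> R) :
  arclength_closed_curve g ->
  (moebius_energy g < +oo)%E ->
  0 < c -> 0 < cbar ->
  (forall n : nat, (2 <= n)%N ->
    [/\ subdivision 1 (b n),
        inscribed_polygon g (b n) (p n) (a n),
        ((c / n%:R)%:E <=
          \big[mine/+oo]_(k < n) (edge_length (g \o b n) k)%:E)%E,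
        (\big[mine/+oo]_(k < n) (edge_length (g \o b n) k)%:E <=
          \big[maxe/-oo]_(k < n) (edge_length (g \o b n) k)%:E)%E &
        (\big[maxe/-oo]_(k < n) (edge_length (g \o b n) k)%:E <=
          (cbar / n%:R)%:E)%E]) ->
  discrete_moebius_energy (polygon_length (g \o b n)) (p n) (a n)
    @[n --> \oo] --> moebius_energy g.
Proof.
move=> curve Efin c0 cbar0 inscribed.
have gp : periodic g 1 by case: curve.
have gL := arclength_curve_lipschitz g curve.
have [k k01 kb] := bilipschitz g gp gL Efin.
have k0 : 0 < k by case/andP: k01.
pose L n := polygon_length (g \o b n).
pose C := cbar / k.
have C0 : 0 < C by rewrite divr_gt0.
have E0 : 0 <= fine (moebius_energy g).
  by rewrite fine_ge0// moebius_energyE// integral_ge0// => z _; exact: moebius_density_ge0.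
have EE : (fine (moebius_energy g))%:E = moebius_energy g.
  rewrite fineK// ge0_fin_numE// moebius_energyE// integral_ge0// => z _.
  exact: moebius_density_ge0.
have data n : (2 <= n)%N -> subdivision 1 (b n) /\ [/\ subdivision (L n) (a n),
    (forall i, p n (a n i) = g (b n i)),
    (forall i, enorm (g (b n (ordS i)) - g (b n i)) = gap (L n) (a n) i),
    (forall i, c / n%:R <= gap (L n) (a n) i) &
    (forall i, enorm (g (b n (ordS i)) - g (b n i)) <= cbar / n%:R)].
  move=> n2; have [sb [[_ sa edge _] pg] lb _ ub] := inscribed n n2.
  have edge' i : enorm (g (b n (ordS i)) - g (b n i)) = gap (L n) (a n) i.
    by have := edge i; rewrite /edge_length/= !pg.
  split=> //; split => // i.
    rewrite -edge' -lee_fin; apply: le_trans lb _.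
    exact: (@bigmin_le_cond _ _ _ _ i).
  rewrite -lee_fin; apply: le_trans ub.
  exact: (@le_bigmax_cond _ _ _ _ i).
(* This holds only for large [n], as [gap_upper_bound] requires [cbar / n < k * (c / 2)]. *)
have gap_ub : \forall n \near \oo, forall i, gap 1 (b n) i <= C / n%:R.
  near=> n.
  have n2 : (2 <= n)%N by near: n; exact: nbhs_infty_ge.
  have [sb [sa pg edge lb ub]] := data n n2.
  have glb i : c / n%:R <= gap 1 (b n) i.
    exact: le_trans (lb i) (edge_le_gap g gp gL _ sb _ _ edge i).
  apply: (gap_upper_bound g k k0 kb n2 (b n) sb c cbar c0 glb ub).
  near: n; apply: near_natdiv_lt.
  by rewrite mulr_gt0// divr_gt0.
have discreteE n : (2 <= n)%N ->
    discrete_moebius_energy (polygon_length (g \o b n)) (p n) (a n) =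
    (\sum_i \sum_(j | i != j) energy_term g (b n) (L n) (a n) i j)%:E.
  move=> n2; have [sb [sa pg edge lb ub]] := data n n2.
  apply: discrete_moebius_energyE => // i j ij.
    exact: (chord_gt0 g gp gL k k01 kb n2 (b n) sb _ _ sa edge i j ij).
  by have [] := polygon_dist_cmp g gp gL (ltnW n2) (b n) sb _ _ sa edge i j ij.
rewrite -EE; apply/fine_cvgP; split.
  by near=> n; rewrite discreteE//; near: n; exact: nbhs_infty_ge.
apply/cvgrPdist_lt => eps eps0.
pose M := 1 + 2 * C / c.
(* [length_defect] reads [1 - L n <= A / n]. *)
pose A := M ^+ 4 * C ^+ 3 / c ^+ 2 * fine (moebius_energy g).
pose B := C * M ^+ 4 / (c * k ^+ 2).
have M0 : 0 < M by rewrite addr_gt0// divr_gt0// mulr_gt0.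
have B0 : 0 <= B.
  by apply: divr_ge0; apply: mulr_ge0; rewrite ?exprn_ge0// ltW.
(* The strip gets half of [eps]; the other half is for the errors of order [1 / n], collected in [K]
   below. *)
pose S := eps / 2 / (2 * B + 1).
have S0 : 0 < S by rewrite !divr_gt0//; lra.
have [r /andP[r0 r1] strip_r] := moebius_strip_small g gp gL Efin S S0.
(* The near-far threshold is [delta = r / 2], which leaves room to enlarge the strip by [2 h] and
   stay within width [r]. *)
pose m := k * (r / 2) / 2.
have m0 : 0 < m by rewrite !(divr_gt0, mulr_gt0).
pose K := 2 / m ^+ 3 * (4 * C + A) + 2 * m ^- 2 * A.
near=> n.
have n2 : (2 <= n)%N by near: n; exact: nbhs_infty_ge.
have n0 : 0 < n%:R :> R by rewrite ltr0n ltnW.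
have [sb [sa pg edge lb ub]] := data n n2.
have gub : forall i, gap 1 (b n) i <= C / n%:R by near: n.
have hm : C / n%:R < m / 2 by near: n; apply: near_natdiv_lt; rewrite divr_gt0.
(* This gives the condition [3 h <= 1 / 2] of [length_defect]. *)
have h6 : C / n%:R < 1 / 6 by near: n; apply: near_natdiv_lt; rewrite divr_gt0.
have hK : K / n%:R < eps / 2 by near: n; apply: near_natdiv_lt; rewrite divr_gt0.
have h0 : 0 < C / n%:R by rewrite divr_gt0.
have mr : m <= r / 4.
  have : k * r <= r by rewrite ler_piMl ?(ltW r0)//; case/andP: k01.
  by rewrite /m; lra.
rewrite /= discreteE//= distrC.
have strip_S : (\int[(@lebesgue_measure R \x @lebesgue_measure R)%E]_(z in
    strip (r / 2 + 2 * (C / n%:R))) moebius_density g z <= S%:E)%E.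
  apply: le_trans (ltW strip_r); apply: ge0_subset_integral.
  - exact: measurable_strip.
  - exact: measurable_strip.
  - by apply: measurable_funTS; apply measurable_moebius_density.
  - by move=> z _; exact: moebius_density_ge0.
  - by move=> z [Qz /= dz]; split => //=; lra.
have r20 : 0 < r / 2 by rewrite divr_gt0.
have hd1 : 2 * (C / n%:R) <= k * (r / 2) / 2 by rewrite -/m; lra.
have hd2 : r / 2 + 2 * (C / n%:R) <= 1 / 2 by lra.
apply: le_lt_trans (total_error g gp gL Efin k k01 kb n2 (b n) sb _ _ sa edge
  c C c0 C0 lb gub _ S r20 hd1 hd2 strip_S) _.
have h3 : 3 * (C / n%:R) <= 1 / 2 by lra.
have := length_defect g gp gL Efin k k01 kb n2 (b n) sb _ _ edge c C c0 lb gub h3.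
rewrite -/M -/B -/m.
have -> : M ^+ 4 * C ^+ 3 / c ^+ 2 / n%:R * fine (moebius_energy g) = A / n%:R.
  by rewrite /A; ring.
move=> LA.
have -> : (2 * B + 1) * S = eps / 2.
  by rewrite /S; field; rewrite gt_eqF//; lra.
have KE : K / n%:R = 2 / m ^+ 3 * (4 * (C / n%:R) + A / n%:R) + 2 * m ^- 2 * (A / n%:R).
  by rewrite /K; ring.
have e1 : 2 / m ^+ 3 * (4 * (C / n%:R) + (1 - L n)) <=
    2 / m ^+ 3 * (4 * (C / n%:R) + A / n%:R).
  by rewrite ler_wpM2l ?lerD2l// divr_ge0// exprn_ge0// ltW.
have e2 : 2 * m ^- 2 * (1 - L n) <= 2 * m ^- 2 * (A / n%:R).
  by rewrite ler_wpM2l// mulr_ge0// invr_ge0 sqr_ge0.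
by rewrite -/(L n); lra.
Unshelve. all: by end_near.
Qed.
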